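(* For every distance set $\Delta\subseteq\mathbb{R}_+$, the Polish group $\mathrm{Isom}(\mathbb{U}_\Delta)$ has property (T). More precisely, for every integer $m\geq 1$, one can find a Kazhdan set $Q_m$ (for $\mathrm{Isom}(\mathbb{U}_\Delta)$) of cardinality $m$ such that $$\sqrt{2-\frac{2\sqrt{2m-1}}{m}}$$ is the optimal Kazhdan constant for $Q_m$.
   Context: A distance set is either a countable additive subsemigroup of the non-negative reals containing $0$, or the intersection $\mathcal{S}\cap[0,r]$ of such a semigroup $\mathcal{S}$ with a bounded interval $[0,r]$, where $r\in\mathcal{S}$. A $\Delta$-metric space is a metric space whose metric takes values in $\Delta$. The Urysohn $\Delta$-metric space $\mathbb{U}_\Delta$ is the unique (up to isometry) countable $\Delta$-metric space which is ultrahomogeneous (every isometry between finite subsets extends to an isometry of $\mathbb{U}_\Delta$ onto itself) and universal (every countable $\Delta$-metric space embeds isometrically into $\mathbb{U}_\Delta$). $\mathrm{Isom}(\mathbb{U}_\Delta)$ is the group of isometries of $\mathbb{U}_\Delta$ onto itself, with the Polish topology of pointwise convergence, $\mathbb{U}_\Delta$ being viewed as a discrete topological space. Unitary representations are homomorphisms into the unitary group of a complex Hilbert space, continuous for the strong operator topology. A topological group $G$ has property (T) if there exist a compact subset $Q\subseteq G$ and $\varepsilon>0$ such that every unitary representation $\pi\colon G\to\mathcal{U}(\mathcal{H})$ having a non-zero vector $\xi\in\mathcal{H}$ with $\sup_{g\in Q}\|\pi(g)\xi-\xi\|\le\varepsilon\|\xi\|$ admits a non-zero $G$-invariant vector. In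 this case $Q$ is called a Kazhdan set for $G$, $\varepsilon$ a Kazhdan constant for $Q$, and $(Q,\varepsilon)$ a Kazhdan pair. The optimal Kazhdan constant for $Q$ is the supremum of the Kazhdan constants for $Q$.
   Formalization: The statement on Q_m assumes Δ ≠ {0} (else the group is trivial); Q_m is claimed to be a Kazhdan set only for m ≥ 2; the optimal constant is the supremum over ε ≥ 0, which for m = 1 gives the value 0, where no positive Kazhdan constant exists. *)

(* Defs.v *)
From HB Require Import structures.
From mathcomp Require Import all_boot all_order all_algebra.
From mathcomp Require Import complex.
From mathcomp Require Import all_classical all_reals all_analysis.

Set Implicit Arguments.
Unset Strict Implicit.
Unset Printing Implicit Defensive.

Import Order.TTheory GRing.Theory Num.Theory.
Import numFieldNormedType.Exports.

Local Open Scope classical_set_scope.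
Local Open Scope ring_scope.

HB.mixin Record isTopologicalGroup G of Topological G & Group G := {
  mulg_continuous : continuous (fun p : G * G => (p.1 * p.2)%g) ;
  invg_continuous : continuous (fun g : G => g^-1%g)
}.

#[short(type="topologicalGroupType")]
HB.structure Definition TopologicalGroup :=
  { G of Topological G & Group G & isTopologicalGroup G }.

(* The norm of a normed module over R[i] takes its values in R[i]; the inner
   product is linear in the first variable. *)
Record hilbertSpace (R : realType) := HilbertSpace {
  hilbert_sort :> completeNormedModType R[i] ;
  inner : {dot hilbert_sort for Num.conj} ;
  inner_norm : forall x : hilbert_sort, inner x x = `|x| ^+ 2
}.

Section KazhdanPropertyT.
Context {R : realType}.

Definition unitary (H : hilbertSpace R) (u : {linear H -> H}) : Prop :=
  isometry (@inner R H) (@inner R H) u /\ forall y, exists x, u x = y.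

Record unitaryRep (G : topologicalGroupType) (H : hilbertSpace R) := UnitaryRep {
  rep_fun :> G -> {linear H -> H} ;
  repM : forall g h x, rep_fun (g * h)%g x = rep_fun g (rep_fun h x) ;
  rep_unitary : forall g, unitary (rep_fun g) ;
  rep_continuous : forall x, continuous (fun g => rep_fun g x)
}.

Context {G : topologicalGroupType}.

Definition almost_invariant (H : hilbertSpace R) (pi : unitaryRep G H)
    (Q : set G) (eps : R) (xi : H) : Prop :=
  forall g, Q g -> `|pi g xi - xi| <= eps%:C%C * `|xi|.

Definition invariant (H : hilbertSpace R) (pi : unitaryRep G H) (xi : H) : Prop :=
  forall g, pi g xi = xi.

Definition almost_invariant_invariant (Q : set G) (eps : R) : Prop :=
  forall (H : hilbertSpace R) (pi : unitaryRep G H),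
    (exists2 xi : H, xi != 0 & almost_invariant pi Q eps xi) ->
    exists2 xi : H, xi != 0 & invariant pi xi.

Definition kazhdan_pair (Q : set G) (eps : R) : Prop :=
  [/\ compact Q, 0 < eps & almost_invariant_invariant Q eps].

Definition kazhdan_set (Q : set G) : Prop := exists eps, kazhdan_pair Q eps.

(* The supremum ranges over eps >= 0 rather than eps > 0. For a Kazhdan set
   this makes no difference (optimal_kazhdan_constantE below); the constant is
   0 when the implication holds for eps = 0 and for no eps > 0, and -oo when it
   already fails for eps = 0. *)
Definition optimal_kazhdan_constant (Q : set G) : \bar R :=
  ereal_sup [set eps%:E | eps in
    [set eps | 0 <= eps /\ almost_invariant_invariant Q eps]].

Lemma optimal_kazhdan_constantE (Q : set G) : kazhdan_set Q ->
  optimal_kazhdan_constant Q =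
  ereal_sup [set eps%:E | eps in [set eps | kazhdan_pair Q eps]].
Proof.
move=> [e0 [cQ e00 he0]]; apply/eqP; rewrite eq_le; apply/andP; split.
- apply: ge_ereal_sup => _ [e [ege0 he] <-].
  have [egt0|] := ltP 0 e.
    by apply: ereal_sup_ubound; exists e.
  move=> ele0; apply: (@le_trans _ _ e0%:E).
    by rewrite lee_fin (le_trans ele0)// ltW.
  by apply: ereal_sup_ubound; exists e0.
- apply: ereal_sup_le => _ [e [_ e_gt0 he] <-]; exists e => //.
  by split => //; exact: ltW.
Qed.

End KazhdanPropertyT.

Definition property_T (R : realType) (G : topologicalGroupType) : Prop :=
  exists (Q : set G) (eps : R), kazhdan_pair Q eps.

Section IsometryGroup.
Context {R : realType} (U : metricType R).

Record isom := Isom {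
  isom_fun :> U -> U ;
  isom_mdist : forall x y, mdist (isom_fun x) (isom_fun y) = mdist x y ;
  isom_surj : forall y, exists x, isom_fun x = y
}.

Lemma isomP (g h : isom) : (forall x, g x = h x) -> g = h.
Proof.
case: g h => [g gd gs] [h hd hs] /= /funext gh.
by rewrite gh in gd gs *; congr Isom; exact: Prop_irrelevance.
Qed.

Lemma isom_inj (g : isom) : injective g.
Proof.
move=> x y gxy; apply: (@mdist_positivity R U).
by rewrite -(isom_mdist g) gxy mdistxx.
Qed.

Definition isom_one : isom :=
  @Isom id (fun _ _ => erefl) (fun y => ex_intro _ y erefl).

Program Definition isom_mul (g h : isom) : isom := @Isom (g \o h) _ _.
Next Obligation. by move=> g h x y; rewrite /= !isom_mdist. Qed.
Next Obligation.
move=> g h y; have [x <-] := isom_surj g y; have [z <-] := isom_surj h x.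
by exists z.
Qed.

Definition isom_inv_fun (g : isom) (y : U) : U := projT1 (cid (isom_surj g y)).

Lemma isom_inv_funK (g : isom) : cancel (isom_inv_fun g) g.
Proof. by move=> y; rewrite /isom_inv_fun; case: cid. Qed.

Lemma isom_funK (g : isom) : cancel g (isom_inv_fun g).
Proof. by move=> x; apply: (isom_inj (g := g)); rewrite isom_inv_funK. Qed.

Program Definition isom_inv (g : isom) : isom := @Isom (isom_inv_fun g) _ _.
Next Obligation. by move=> g x y; rewrite -(isom_mdist g) !isom_inv_funK. Qed.
Next Obligation. by move=> g y; exists (g y); rewrite isom_funK. Qed.

HB.instance Definition _ := gen_eqMixin isom.
HB.instance Definition _ := gen_choiceMixin isom.

Lemma isom_mulA : associative isom_mul. Proof. by move=> *; exact: isomP. Qed.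
Lemma isom_mul1 : left_id isom_one isom_mul. Proof. by move=> *; exact: isomP. Qed.
Lemma isom_mulg1 : right_id isom_one isom_mul. Proof. by move=> *; exact: isomP. Qed.
Lemma isom_mulV : left_inverse isom_one isom_inv isom_mul.
Proof. by move=> g; apply: isomP => x /=; exact: isom_funK. Qed.
Lemma isom_mulgV : right_inverse isom_one isom_inv isom_mul.
Proof. by move=> g; apply: isomP => x /=; exact: isom_inv_funK. Qed.

HB.instance Definition _ := isGroup.Build isom
  isom_mulA isom_mul1 isom_mulg1 isom_mulV isom_mulgV.

(* Pointwise convergence, U being discrete: the metric topology of U plays no
   role here. *)
HB.instance Definition _ := Topological.copy isom
  (initial_topology
    (fun g : isom => (g : U -> U) : {ptws U -> discrete_topology U})).

Lemma near_isom (g : isom) (x : U) : \forall h \near g, (h : isom) x = g x.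
Proof.
pose f (g : isom) : {ptws U -> discrete_topology U} := (g : U -> U).
have cf : f h @[h --> g] --> f g by exact: initial_continuous.
have cx : {for f g, continuous
    (fun k : {ptws U -> discrete_topology U} => k x : discrete_topology U)}.
  exact: (@proj_continuous U (fun=> discrete_topology U) x).
have nb : nbhs (g x : discrete_topology U) [set y | y = g x].
  by rewrite nbhs_principalE.
exact: (cvg_comp _ _ cf cx _ nb).
Qed.

Lemma isom_cvg (T : Type) (F : set_system T) (FF : Filter F) (f : T -> isom)
    (g : isom) :
  (forall x, \forall t \near F, f t x = g x) -> f t @[t --> F] --> g.
Proof.
move=> fg.
pose i (g : isom) : {ptws U -> discrete_topology U} := (g : U -> U).
have cif : i (f t) @[t --> F] --> i g.
  apply/cvg_sup => x A [_ [[W oW <-] Wg] WA].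
  apply: filterS (fg x) => t ftx; apply: WA.
  by rewrite /= /i ftx.
move=> A [_ [[W oW <-] Wg] WA].
have nW : nbhs (i g) W by exact: open_nbhs_nbhs.
have fW : F [set t | W (i (f t))] by exact: (cif _ nW).
have : F [set t | A (f t)] by apply: filterS fW => t Wt; exact: WA.
exact.
Qed.

Lemma isom_mul_continuous :
  continuous (fun p : isom * isom => (p.1 * p.2)%g).
Proof.
move=> [g h]; apply: isom_cvg => x.
exists ([set g' : isom | g' (h x) = g (h x)], [set h' : isom | h' x = h x]).
  by split; exact: near_isom.
by move=> [g' h'] [/= gx hx]; rewrite hx gx.
Qed.

Lemma isom_inv_continuous : continuous (fun g : isom => g^-1%g).
Proof.
move=> g; apply: (isom_cvg (nbhs_filter g)) => x.
have /= := near_isom g (g^-1%g x).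
apply: (@filterS _ _ (nbhs_filter g)) => h hgx.
by apply: (isom_inj (g := h)); rewrite hgx /= !isom_inv_funK.
Qed.

HB.instance Definition _ := isTopologicalGroup.Build isom
  isom_mul_continuous isom_inv_continuous.

End IsometryGroup.

Section Urysohn.
Context {R : realType}.

Definition countable_subsemigroup (S : set R) : Prop :=
  [/\ countable S, S `<=` [set x | 0 <= x], S 0 &
      forall x y, S x -> S y -> S (x + y)].

Definition distance_set (Delta : set R) : Prop :=
  countable_subsemigroup Delta \/
  exists (S : set R) (r : R),
    [/\ countable_subsemigroup S, S r & Delta = S `&` `[0, r]].

Definition delta_metric (Delta : set R) (X : metricType R) : Prop :=
  forall x y : X, Delta (mdist x y).

Definition ultrahomogeneous (X : metricType R) : Prop :=
  forall (A : set X) (f : X -> X), finite_set A ->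
    (forall x y, A x -> A y -> mdist (f x) (f y) = mdist x y) ->
    exists g : isom X, forall x, A x -> g x = f x.

Definition universal (Delta : set R) (X : metricType R) : Prop :=
  forall Y : metricType R, countable [set: Y] -> delta_metric Delta Y ->
    exists f : Y -> X, forall x y, mdist (f x) (f y) = mdist x y.

Definition urysohn_space (Delta : set R) (X : metricType R) : Prop :=
  [/\ countable [set: X], delta_metric Delta X, ultrahomogeneous X &
      universal Delta X].

End Urysohn.

(* Main.v *)
Require Import Defs.
From HB Require Import structures.
From mathcomp Require Import all_boot all_order all_algebra.
From mathcomp Require Import complex finmap.
From mathcomp Require Import ring lra.
From mathcomp Require Import all_classical all_reals all_analysis.
From mathcomp Require summability.

Set Implicit Arguments.
Unset Strict Implicit.
Unset Printing Implicit Defensive.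

Import Order.TTheory GRing.Theory Num.Theory.
Import numFieldNormedType.Exports.
Local Open Scope classical_set_scope.
Local Open Scope ring_scope.

(** Let [G] be the isometry group. Everything rests on two facts.

    The first one describes the unitary representations of [G]. Vectors fixed
    by the pointwise stabiliser of some finite set are dense
    ([fixed_dense]). Let the pure vectors of a finite set [A] be the vectors
    fixed by the stabiliser of [A] and orthogonal to those fixed by the
    stabiliser of a proper subset. Then pure vectors of distinct sets are
    orthogonal ([pure_orthogonal]) and each vector fixed by the stabiliser of
    [A] is a sum of pure ones ([pure_decomposition]), so that a representation
    is the orthogonal sum of its pure spaces, which [G] permutes as it
    permutes the finite subsets; the one of the empty set consists of the
    invariant vectors. Orthogonality comes from [dissociation]: a coefficient
    [<pi h x, y>], with [x] fixed by the stabiliser of [a |` E] and [y] by that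
    of [B], is a function of the distances from [h a] to [B], and it is
    constant as long as [h a] avoids [B]. Indeed, if two such distance functions differ by at most [s] and
    are at least [s], points realising them can alternate in a sequence of
    points mutually at distance [s]; the vectors of the sequence then converge
    weakly, and their coefficients have a single limit. Steps of this kind
    connect all distance functions, because distances can be added as long as
    they do not exceed the diameter.

    The second one provides isometries [g 1, ..., g m] in general position
    ([growth_exists]). They are built by back and forth, and each new edge
    [x -- g i x] has an end that was isolated before; this keeps the graph a
    forest. Orienting the edges from their fresh end to their old end, and the
    edges between finite sets as their latest constituents, gives every
    nonempty finite set at most one outgoing edge ([leaves_uniq]). A weighted
    arithmetic-geometric inequality along these edges is Kesten's bound for
    the free group ([kesten_bound]):
    [sum_i Re <pi (g i) x, x> <= sqrt (2 m - 1) |x|^2]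
    in each representation without invariant vectors ([spectral_bound]). A
    unit vector moved by at most [eps] by each [g i] makes the left-hand side
    at least [m (1 - eps^2 / 2)], so [eps^2 >= 2 - 2 sqrt (2 m - 1) / m]. When
    [m = 1] the bound is [0], and one also has to see that [g 1] alone has no
    invariant vector ([generator_no_invariant]).

    The constant is optimal because of the permutation representation on the
    square-summable families indexed by the space. It has no invariant vector,
    the action being transitive on an infinite set, and on the tree that the
    [g i] span from a root the truncated radial functions with values
    [(2 m - 1)^(- n / 2)] at distance [n] are moved by amounts tending to the
    constant ([radial_almost_invariant]). *)

(** * The real Hilbert space underlying a complex one *)

Section RealInnerProduct.
Context {R : realType} {H : hilbertSpace R}.
Implicit Types (x y z : H) (r : R).

Definition rdot x y : R := complex.Re (inner H x y).
Definition nrm x : R := complex.Re `|x|.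

Lemma rdotC x y : rdot x y = rdot y x.
Proof.
have Re_conj (z : R[i]) : complex.Re (Num.conj z) = complex.Re z by case: z.
by rewrite /rdot hermC expr0 mul1r; exact: Re_conj.
Qed.

Lemma rdotDl x y z : rdot (x + y) z = rdot x z + rdot y z.
Proof. by rewrite /rdot linearDl raddfD. Qed.

Lemma rdotNl x z : rdot (- x) z = - rdot x z.
Proof. by rewrite /rdot linearNl raddfN. Qed.

Lemma rdotZl r x z : rdot (r%:C%C *: x) z = r * rdot x z.
Proof.
rewrite /rdot linearZl_LR /=.
by case: (inner H x z) => a b /=; rewrite mul0r subr0.
Qed.

Lemma nrmE x : `|x| = (nrm x)%:C%C.
Proof. by rewrite /nrm RRe_real. Qed.


Lemma rdotDr x y z : rdot x (y + z) = rdot x y + rdot x z.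
Proof. by rewrite !(rdotC x) rdotDl. Qed.

Lemma rdotNr x z : rdot x (- z) = - rdot x z.
Proof. by rewrite !(rdotC x) rdotNl. Qed.

Lemma rdotBl x y z : rdot (x - y) z = rdot x z - rdot y z.
Proof. by rewrite rdotDl rdotNl. Qed.

Lemma rdotBr x y z : rdot x (y - z) = rdot x y - rdot x z.
Proof. by rewrite rdotDr rdotNr. Qed.

Lemma rdotZr r x z : rdot x (r%:C%C *: z) = r * rdot x z.
Proof. by rewrite !(rdotC x) rdotZl. Qed.

Lemma rdot0l z : rdot 0 z = 0.
Proof. by rewrite -(subrr 0) rdotBl subrr. Qed.

Lemma rdot0r z : rdot z 0 = 0.
Proof. by rewrite rdotC rdot0l. Qed.

Lemma rdot_suml (I : Type) (s : seq I) (P : pred I) (F : I -> H) z :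
  rdot (\sum_(i <- s | P i) F i) z = \sum_(i <- s | P i) rdot (F i) z.
Proof.
by apply: (big_morph (rdot^~ z)) => [x y|]; rewrite ?rdotDl ?rdot0l.
Qed.

Lemma rdot_sumr (I : Type) (s : seq I) (P : pred I) (F : I -> H) z :
  rdot z (\sum_(i <- s | P i) F i) = \sum_(i <- s | P i) rdot z (F i).
Proof. by rewrite rdotC rdot_suml; apply: eq_bigr => i _; rewrite rdotC. Qed.

Lemma rdotxx x : rdot x x = nrm x ^+ 2.
Proof.
rewrite /rdot inner_norm nrmE -rmorphXn /=.
by [].
Qed.

Lemma nrm_ge0 x : 0 <= nrm x.
Proof. by rewrite -ler0c -nrmE. Qed.

Lemma nrm0 : nrm 0 = 0 :> R.
Proof. by rewrite /nrm normr0. Qed.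

Lemma nrm_eq0 x : nrm x = 0 -> x = 0.
Proof. by move=> x0; apply: normr0_eq0; rewrite nrmE x0. Qed.

Lemma nrm_gt0 x : x != 0 -> 0 < nrm x.
Proof.
move=> x0; rewrite lt_neqAle nrm_ge0 andbT eq_sym.
by apply: contra x0 => /eqP/nrm_eq0 ->.
Qed.

Lemma ler_nrmD x y : nrm (x + y) <= nrm x + nrm y.
Proof. by rewrite -lecR rmorphD /= -!nrmE ler_normD. Qed.

Lemma nrmN x : nrm (- x) = nrm x.
Proof. by rewrite /nrm normrN. Qed.

Lemma nrm_distC x y : nrm (x - y) = nrm (y - x).
Proof. by rewrite -nrmN opprB. Qed.

Lemma ler_nrm_dist z x y : nrm (x - y) <= nrm (x - z) + nrm (z - y).
Proof. by rewrite -[x - y](subrKA z) ler_nrmD. Qed.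

Lemma nrmZ r x : nrm (r%:C%C *: x) = `|r| * nrm x.
Proof.
apply: (@complexI R); rewrite rmorphM /= -nrmE normrZ -nrmE; congr (_ * _).
by rewrite normc_def /= expr0n /= addr0 sqrtr_sqr.
Qed.

Lemma sqr_nrmD x y : nrm (x + y) ^+ 2 = nrm x ^+ 2 + nrm y ^+ 2 + 2 * rdot x y.
Proof.
rewrite -!rdotxx rdotDl !rdotDr (rdotC y x).
by ring.
Qed.

Lemma sqr_nrmB x y : nrm (x - y) ^+ 2 = nrm x ^+ 2 + nrm y ^+ 2 - 2 * rdot x y.
Proof. by rewrite sqr_nrmD nrmN rdotNr mulrN. Qed.

Lemma rdot_le x y : rdot x y <= nrm x * nrm y.
Proof.
have [->|x0] := eqVneq x 0; first by rewrite rdot0l nrm0 mul0r.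
have [->|y0] := eqVneq y 0; first by rewrite rdot0r nrm0 mulr0.
have := sqr_ge0 (nrm ((nrm y)%:C%C *: x - (nrm x)%:C%C *: y)).
rewrite sqr_nrmB !nrmZ rdotZl rdotZr !ger0_norm ?nrm_ge0//.
have := mulr_gt0 (nrm_gt0 x0) (nrm_gt0 y0).
set a := nrm x; set b := nrm y => ab0.
have -> : (b * a) ^+ 2 + (a * b) ^+ 2 - 2 * (b * (a * rdot x y)) =
          (a * b) * (2 * (a * b - rdot x y)) by ring.
by rewrite pmulr_rge0// pmulr_rge0// subr_ge0.
Qed.

Lemma normr_rdot_le x y : `|rdot x y| <= nrm x * nrm y.
Proof.
by rewrite ler_norml rdot_le andbT lerNl -rdotNl (le_trans (rdot_le _ _))// nrmN.
Qed.

Lemma nrm_complete (u : nat -> H) :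
  (forall e, 0 < e -> exists N, forall n m, (N <= n)%N -> (N <= m)%N ->
    nrm (u n - u m) < e) ->
  exists p, forall e, 0 < e -> exists N, forall n, (N <= n)%N -> nrm (u n - p) < e.
Proof.
move=> ucauchy.
have : cauchy (u n @[n --> \oo]).
  apply: cauchy_exP => e e0.
  have eE : e = (complex.Re e)%:C%C by rewrite RRe_real// gtr0_real.
  have /ucauchy[N uN] : 0 < complex.Re e by rewrite -ltcR -eE.
  exists (u N); exists N => // n /= Nn.
  by rewrite -ball_normE /= eE nrmE ltcR; apply: uN.
move=> /cauchy_cvg/cvg_ex[p up]; exists p => e e0.
have e0C : 0 < e%:C%C by rewrite ltcR.
have [N _ Np] := (cvgrPdist_lt _ _).1 up _ e0C.
by exists N => n Nn; have := Np n Nn; rewrite /= nrmE ltcR nrm_distC.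
Qed.

(** Closure is expressed by approximation in norm, the form in which limits
    enter all estimates below. *)
Definition adherent (S : set H) (p : H) : Prop :=
  forall e, 0 < e -> exists2 s, S s & nrm (s - p) < e.

Definition midpoint x y : H := (2^-1)%:C%C *: (x + y).

Lemma midpointxx x : midpoint x x = x.
Proof.
rewrite /midpoint -mulr2n -(scaler_nat 2 x) scalerA.
rewrite -[X in _ * X](rmorph_nat (real_complex R)) -rmorphM /= mulVf ?scale1r//.
Qed.

Lemma sqr_nrm_midpoint x y :
  nrm (x - y) ^+ 2 =
  2 * nrm x ^+ 2 + 2 * nrm y ^+ 2 - 4 * nrm (midpoint x y) ^+ 2.
Proof.
rewrite nrmZ exprMn real_normK ?num_real// sqr_nrmB sqr_nrmD.
by field.
Qed.

(** The parallelogram law makes any norm-minimising sequence Cauchy. *)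
Lemma min_norm_ex (S : set H) : S !=set0 ->
  (forall x y, S x -> S y -> S (midpoint x y)) ->
  exists p, adherent S p /\ forall s, S s -> nrm p <= nrm s.
Proof.
move=> [s0 Ss0] Smid.
pose D := [set nrm s | s in S]; pose d := inf D.
have infD : has_inf D.
  by split; [exists (nrm s0), s0|exists 0 => _ [s _ <-]; exact: nrm_ge0].
have d_le s : S s -> d <= nrm s by move=> Ss; apply: inf_lbound; [case: infD|exists s].
have d_ge0 : 0 <= d by apply: lb_le_inf; [exists (nrm s0), s0|move=> _ [s _ <-]; exact: nrm_ge0].
have uex (n : nat) : exists s, S s /\ nrm s < d + n.+1%:R^-1.
  have n0 : 0 < n.+1%:R^-1 :> R by rewrite invr_gt0 ltr0n.
  have [_ [s Ss <-] sd] := inf_adherent n0 infD.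
  by exists s.
have [u uP] := choice uex.
have near_d e : 0 < e -> exists N, forall n, (N <= n)%N -> nrm (u n) < d + e.
  move=> e0; have [N _ Ne] := near_infty_natSinv_lt (PosNum e0).
  exists N => n Nn; have [_ ud] := uP n; apply: (lt_le_trans ud).
  by rewrite lerD2l ltW//; exact: Ne.
have close e a b : 0 < e -> S a -> S b -> nrm a < d + e -> nrm b < d + e ->
    nrm (a - b) ^+ 2 < 8 * d * e + 4 * e ^+ 2.
  move=> e0 Sa Sb ad bd; rewrite sqr_nrm_midpoint.
  have := d_le _ (Smid _ _ Sa Sb); set c := nrm (midpoint a b) => dc.
  have sq z : nrm z < d + e -> nrm z ^+ 2 < (d + e) ^+ 2.
    by move=> zd; rewrite ltr_sqr// nnegrE ?nrm_ge0// addr_ge0// ltW.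
  have := sq _ ad; have := sq _ bd.
  have : d ^+ 2 <= c ^+ 2 by rewrite ler_sqr// nnegrE nrm_ge0.
  by nra.
have [e e0|p up] := @nrm_complete u.
  pose t := Num.min 1 (e ^+ 2 / (8 * d + 4)).
  have den : 0 < 8 * d + 4 by lra.
  have t0 : 0 < t by rewrite lt_min ltr01 divr_gt0// exprn_gt0.
  have [N Nt] := near_d _ t0; exists N => n m Nn Nm.
  have [Sn _] := uP n; have [Sm _] := uP m.
  have := close _ _ _ t0 Sn Sm (Nt _ Nn) (Nt _ Nm).
  have t1 : t <= 1 by rewrite ge_min lexx.
  have te : t * (8 * d + 4) <= e ^+ 2 by rewrite -ler_pdivlMr// ge_min lexx orbT.
  move=> lt; rewrite -ltr_sqr ?nnegrE ?nrm_ge0 ?(ltW e0)//.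
  by nra.
exists p; split=> [e e0|s Ss].
  have [N Np] := up _ e0; exists (u N); first by have [] := uP N.
  exact: Np.
apply: (le_trans _ (d_le _ Ss)); apply/ler_addgt0Pr => e e0.
have e20 : 0 < e / 2 by rewrite divr_gt0.
have [N Np] := up _ e20; have [M Md] := near_d _ e20.
have -> : p = u (maxn N M) - (u (maxn N M) - p) by rewrite subKr.
apply: (le_trans (ler_nrmD _ _)); rewrite nrmN.
have := Np (maxn N M) (leq_maxl _ _); have := Md (maxn N M) (leq_maxr _ _).
by lra.
Qed.

(** The midpoint of two minimisers would be shorter, again by the
    parallelogram law. *)
Lemma min_norm_uniq (S : set H) p p' :
  (forall x y, S x -> S y -> S (midpoint x y)) ->
  adherent S p -> adherent S p' ->
  (forall s, S s -> nrm p <= nrm s) -> (forall s, S s -> nrm p' <= nrm s) -> p = p'.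
Proof.
move=> Smid Sp Sp' minp minp'.
have adh_ge q z : adherent S z -> (forall s, S s -> nrm q <= nrm s) -> nrm q <= nrm z.
  move=> Sz minq; apply/ler_addgt0Pr => e e0; have [s Ss sz] := Sz e e0.
  apply: (le_trans (minq _ Ss)); rewrite -[s](subrK z) addrC.
  by apply: (le_trans (ler_nrmD _ _)); rewrite lerD2l ltW.
have adh_mid : adherent S (midpoint p p').
  move=> e e0; have [s Ss sp] := Sp e e0; have [s' Ss' sp'] := Sp' e e0.
  exists (midpoint s s'); first exact: Smid.
  rewrite /midpoint -scalerBr nrmZ ger0_norm ?invr_ge0//.
  rewrite opprD addrACA; have := ler_nrmD (s - p) (s' - p').
  by lra.
have pp' : nrm p = nrm p' by apply/eqP; rewrite eq_le !adh_ge.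
have pm := adh_ge p _ adh_mid minp.
apply/eqP; rewrite -subr_eq0; apply/eqP/nrm_eq0/eqP.
rewrite -sqrf_eq0 eq_le sqr_ge0 andbT sqr_nrm_midpoint -pp'.
have : nrm p ^+ 2 <= nrm (midpoint p p') ^+ 2 by rewrite ler_sqr// nnegrE nrm_ge0.
by lra.
Qed.

Definition closed_subspace (K : set H) : Prop :=
  [/\ K 0, forall x y, K x -> K y -> K (x + y),
      forall r x, K x -> K (r%:C%C *: x) &
      forall p, adherent K p -> K p].

(** The difference [x - k] is the shortest vector of [x - K]. *)
Lemma projection_ex (K : set H) x : closed_subspace K ->
  exists2 k, K k & forall z, K z -> rdot (x - k) z = 0.
Proof.
move=> [K0 KD KZ Kcl].
have KN z : K z -> K (- z).
  by move=> /(KZ (-1)); rewrite rmorphN1 scaleN1r.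
pose S := [set x - k | k in K].
have [||p [adhp minp]] := @min_norm_ex S.
- by exists (x - 0), 0.
- move=> _ _ [k Kk <-] [l Kl <-]; exists (midpoint k l); first exact/KZ/KD.
  by rewrite -{1}[x]midpointxx /midpoint -scalerBr opprD addrACA.
have Kp : K (x - p).
  apply: Kcl => e e0; have [_ [k Kk <-] kp] := adhp e e0.
  by exists k => //; rewrite nrm_distC addrAC.
exists (x - p) => // z Kz; rewrite subKr.
(* The value of this quadratic polynomial at its minimum gives the claim. *)
have opt t : 0 <= t ^+ 2 * nrm z ^+ 2 - 2 * t * rdot p z.
  have Sz : S (p - t%:C%C *: z).
    exists (x - p + t%:C%C *: z); first by apply: KD => //; exact: KZ.
    by rewrite opprD opprB addrA subrKC.
  have : nrm p ^+ 2 <= nrm (p - t%:C%C *: z) ^+ 2.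
    by rewrite ler_sqr ?minp ?nnegrE ?nrm_ge0.
  rewrite sqr_nrmB nrmZ exprMn real_normK ?num_real// rdotZr.
  by lra.
have [->|z0] := eqVneq z 0; first by rewrite rdot0r.
have := opt (rdot p z / nrm z ^+ 2).
have z20 : nrm z ^+ 2 != 0 by rewrite sqrf_eq0 gt_eqF// nrm_gt0.
set a := rdot p z; set b := nrm z ^+ 2 => h.
have : a ^+ 2 / b <= 0.
  rewrite -oppr_ge0; suff <- : (a / b) ^+ 2 * b - 2 * (a / b) * a = - (a ^+ 2 / b) by [].
  by field.
rewrite pmulr_lle0; last by rewrite invr_gt0 exprn_gt0// nrm_gt0.
by move=> le0; apply/eqP; rewrite -sqrf_eq0 eq_le le0 sqr_ge0.
Qed.

End RealInnerProduct.

(** * Unitary representations and vectors fixed by stabilisers *)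

Section Representation.
Context {R : realType} {G : topologicalGroupType} {H : hilbertSpace R}.
Variable pi : unitaryRep G H.
Implicit Types (g h : G) (x y : H).

Lemma rep_rdot g x y : rdot (pi g x) (pi g y) = rdot x y.
Proof. by have [iso _] := rep_unitary pi g; rewrite /rdot iso. Qed.

Lemma rep_nrm g x : nrm (pi g x) = nrm x.
Proof.
apply/eqP; rewrite -(@eqrXn2 _ 2) ?nrm_ge0//.
by rewrite -!rdotxx rep_rdot.
Qed.

Lemma rep1 x : pi 1%g x = x.
Proof.
apply/eqP; rewrite -subr_eq0; apply/eqP/nrm_eq0.
by rewrite -(rep_nrm 1%g) linearB -repM mul1g subrr nrm0.
Qed.

Lemma repK g x : pi g (pi g^-1%g x) = x.
Proof. by rewrite -repM mulgV rep1. Qed.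

Lemma rep_adj g x y : rdot (pi g x) y = rdot x (pi g^-1%g y).
Proof. by rewrite -{1}[y](repK g) rep_rdot. Qed.

Lemma rep_midpoint g x y : pi g (midpoint x y) = midpoint (pi g x) (pi g y).
Proof. by rewrite /midpoint linearZ linearD. Qed.

End Representation.

Section FixedVectors.
Context {R : realType} {U : metricType R} {H : hilbertSpace R}.
Variable pi : unitaryRep (isom U) H.
Implicit Types (g h : isom U) (x y : H) (A B : {fset U}).

Definition fixes g A : Prop := forall a, a \in A -> g a = a.

Lemma fixes1 A : fixes 1%g A. Proof. by []. Qed.

Lemma fixesM g h A : fixes g A -> fixes h A -> fixes (g * h)%g A.
Proof. by move=> gA hA a aA; rewrite /= hA// gA. Qed.

Lemma isomVK g : cancel g (g^-1%g : isom U).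
Proof. exact: isom_funK. Qed.

Lemma isomKV g : cancel (g^-1%g : isom U) g.
Proof. exact: isom_inv_funK. Qed.

Lemma fixesV g A : fixes g A -> fixes g^-1%g A.
Proof. by move=> gA a aA; rewrite -{1}(gA a aA) isomVK. Qed.

Lemma fixesS g A B : (A `<=` B)%fset -> fixes g B -> fixes g A.
Proof. by move=> /fsubsetP AB gB a aA; apply: gB; exact: AB. Qed.

Definition fixed A x : Prop := forall g, fixes g A -> pi g x = x.

Lemma fixedS A B x : (A `<=` B)%fset -> fixed A x -> fixed B x.
Proof. by move=> AB fx g gB; apply: fx; exact: fixesS AB gB. Qed.

Lemma fixed0 A : fixed A 0. Proof. by move=> g _; rewrite linear0. Qed.

Lemma fixedD A x y : fixed A x -> fixed A y -> fixed A (x + y).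
Proof. by move=> fx fy g gA; rewrite linearD fx// fy. Qed.

Lemma fixedN A x : fixed A x -> fixed A (- x).
Proof. by move=> fx g gA; rewrite linearN fx. Qed.

Lemma fixedZ A c x : fixed A x -> fixed A (c *: x).
Proof. by move=> fx g gA; rewrite linearZ fx. Qed.

Lemma fixed_adherent A p : adherent (fixed A) p -> fixed A p.
Proof.
move=> adh g gA; apply/eqP; rewrite -subr_eq0; apply/eqP/nrm_eq0/eqP.
rewrite eq_le nrm_ge0 andbT; apply/ler_addgt0Pr => e e0; rewrite add0r.
have [s fs sp] := adh (e / 2) (ltac:(by rewrite divr_gt0)).
apply: (le_trans (ler_nrm_dist s _ _)).
rewrite -{1}(fs g gA) -linearB rep_nrm (nrm_distC p).
by rewrite [leRHS]splitr lerD// ltW.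
Qed.

Lemma fixed_rep A g x : fixed A x -> fixed [fset g a | a in A]%fset (pi g x).
Proof.
move=> fx h hgA; rewrite -[LHS](repK pi g); congr (pi g _); rewrite -!repM; apply: fx => a aA.
by rewrite /= hgA ?isom_funK// in_imfset.
Qed.

Lemma fixed_eq A x g h : fixed A x -> (forall a, a \in A -> g a = h a) ->
  pi g x = pi h x.
Proof.
move=> fx gh; rewrite -[LHS](repK pi h); congr (pi h _); rewrite -repM.
by apply: fx => a aA; rewrite /= gh// isom_funK.
Qed.

(** Midpoints alone, rather than all convex combinations, suffice for the
    minimal norm argument. *)
Inductive orbit_hull A x : set H :=
| hull_orbit g : fixes g A -> orbit_hull A x (pi g x)
| hull_midpoint y z :
    orbit_hull A x y -> orbit_hull A x z -> orbit_hull A x (midpoint y z).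

Lemma orbit_hull_rep A x g y :
  fixes g A -> orbit_hull A x y -> orbit_hull A x (pi g y).
Proof.
move=> gA; elim=> [h hA|z t _ IHz _ IHt]; last by rewrite rep_midpoint; right.
by rewrite -repM; left; exact: fixesM.
Qed.

Lemma orbit_hull_rdot A x y z :
  fixed A z -> orbit_hull A x y -> rdot y z = rdot x z.
Proof.
move=> fz; elim=> [h hA|u v _ IHu _ IHv].
  by rewrite rep_adj fz//; exact: fixesV.
by rewrite /midpoint rdotZl rdotDl IHu IHv; field.
Qed.

Lemma orbit_hull_near A x e y :
  (forall g, fixes g A -> nrm (pi g x - x) <= e) ->
  orbit_hull A x y -> nrm (y - x) <= e.
Proof.
move=> xe; elim=> [h hA|u v _ IHu _ IHv]; first exact: xe.
rewrite -[x in _ - x]midpointxx /midpoint -scalerBr nrmZ ger0_norm ?invr_ge0//.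
rewrite opprD addrACA; have := ler_nrmD (u - x) (v - x).
by lra.
Qed.

(** The point of minimal norm of the closed hull of an orbit is unique, hence
    fixed by the group. *)
Lemma orbit_hull_fixed A x : exists2 p, fixed A p & adherent (orbit_hull A x) p.
Proof.
have mid y z : orbit_hull A x y -> orbit_hull A x z -> orbit_hull A x (midpoint y z).
  by move=> *; right.
have [|p [adhp minp]] := @min_norm_ex _ _ (orbit_hull A x) _ mid.
  by exists (pi 1%g x); left; exact: fixes1.
exists p => // g gA; apply: (min_norm_uniq mid _ adhp _ minp).
  move=> e e0; have [s Ss sp] := adhp e e0.
  by exists (pi g s); [exact: orbit_hull_rep|rewrite -linearB rep_nrm].
by move=> s Ss; rewrite rep_nrm; exact: minp.
Qed.

(** The stabilisers of finite sets form a filter along which each point is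
    eventually fixed, so that this filter converges to [1]. *)
Lemma nbhs1_fixes (W : set (isom U)) : nbhs (1%g : isom U) W ->
  exists A, forall g, fixes g A -> W g.
Proof.
pose F (V : set (isom U)) := exists A, forall g, fixes g A -> V g.
have FF : Filter F.
  split; first by exists fset0.
  - move=> V V' [A AV] [B BV']; exists (A `|` B)%fset => g gAB; split.
      by apply: AV; apply: fixesS gAB; exact: fsubsetUl.
    by apply: BV'; apply: fixesS gAB; exact: fsubsetUr.
  - by move=> V V' VV' [A AV]; exists A => g /AV; exact: VV'.
apply: (@isom_cvg _ U _ F FF id 1%g) => a.
by exists [fset a]%fset => g /(_ a); rewrite in_fset1 eqxx; exact.
Qed.

(** Continuity makes the vectors fixed by the stabiliser of some finite set
    dense. *)
Lemma fixed_dense x e : 0 < e -> exists A y, fixed A y /\ nrm (y - x) <= e.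
Proof.
move=> e0.
have e20 : 0 < e / 2 by rewrite divr_gt0.
have e20C : 0 < (e / 2)%:C%C by rewrite ltcR.
have [A Ax] : exists A, forall g, fixes g A -> nrm (pi g x - x) <= e / 2.
  have := (cvgrPdist_le _ _).1 (@rep_continuous _ _ _ pi x 1%g) _ e20C => nb.
  have [A Ax] := nbhs1_fixes (nb _); exists A => g /Ax; rewrite /= rep1 nrmE lecR.
  by rewrite nrm_distC.
have [p fp adhp] := orbit_hull_fixed A x; exists A, p; split => //.
have [s Ss sp] := adhp _ e20.
apply: (le_trans (ler_nrm_dist s _ _)); rewrite nrm_distC.
have := orbit_hull_near Ax Ss.
by lra.
Qed.

End FixedVectors.

(** * One-point extensions in the Urysohn space *)

Section MetricOfDistance.
Context {R : realType} {T : choiceType} (d : T -> T -> R).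

(** An alias of [T] to which the metric structure given by [d] is attached. *)
Definition metric_carrier (d0 : forall x, d x x = 0)
  (dpos : forall x y, d x y = 0 -> x = y) (dC : forall x y, d x y = d y x)
  (dtri : forall y x z, d x z <= d x y + d y z) : Type := T.

Context (d0 : forall x, d x x = 0) (dpos : forall x y, d x y = 0 -> x = y)
  (dC : forall x y, d x y = d y x) (dtri : forall y x z, d x z <= d x y + d y z).

HB.instance Definition _ := Choice.copy (metric_carrier d0 dpos dC dtri) T.
HB.instance Definition _ :=
  isMetric.Build R (metric_carrier d0 dpos dC dtri) d0 dpos dC dtri.

Lemma metric_of_distance :
  exists (M : metricType R) (f : T -> M), (forall y, exists x, f x = y) /\
    forall x y, mdist (f x) (f y) = d x y.
Proof.
exists (metric_carrier d0 dpos dC dtri), id; split=> // y.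
by exists y.
Qed.

End MetricOfDistance.

Section Extension.
Context {R : realType} {Delta : set R} {U : metricType R}.
Context (hDelta : distance_set Delta) (hU : urysohn_space Delta U).
Implicit Types (F A B : {fset U}) (k : U -> R) (s : R).

Lemma distance_set0 : Delta 0.
Proof.
case: hDelta => [[]//|[S [r [[_ Sge S0 _] Sr ->]]]]; split => //.
by rewrite /= in_itv /= lexx; exact: Sge.
Qed.

Lemma distance_set_ge0 x : Delta x -> 0 <= x.
Proof.
case: hDelta => [[_ Sge _ _]|[S [r [[_ Sge _ _] _ ->]]]]; first exact: Sge.
by move=> [Sx _]; exact: Sge.
Qed.

Lemma distance_setD x y z : Delta x -> Delta y -> Delta z -> x + y <= z ->
  Delta (x + y).
Proof.
case: hDelta => [[_ _ _ SD] Dx Dy _ _|[S [r [[_ Sge _ SD] _ ->]]]]; first exact: SD.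
move=> [Sx _] [Sy _] [_ +] xyz; rewrite /= !in_itv /= => /andP[_ zr].
split; first exact: SD.
by rewrite (le_trans xyz zr) andbT addr_ge0//; exact: Sge.
Qed.

(** The possible distances from the points of [F] to one additional point. *)
Definition katetov F k : Prop :=
  [/\ forall x, x \in F -> Delta (k x), forall x, x \in F -> 0 < k x &
      forall x y, x \in F -> y \in F -> k x - k y <= mdist x y <= k x + k y].

Lemma katetov_dist F a : a \notin F -> katetov F (mdist a).
Proof.
have [_ hD _ _] := hU; move=> aF; split=> [x _|x xF|x y _ _]; first exact: hD.
  by rewrite mdist_gt0; apply: contraNneq aF => ->.
have := metric_triangle a y x; have := metric_triangle x a y.
by rewrite (metric_sym y x) (metric_sym x a) => ? ?; lra.
Qed.

(** Adjoin the new points to [F] abstractly, embed the result by universality,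
    and bring the copy of [F] back by ultrahomogeneity. The common mutual
    distance [s] makes the translates of a vector along such a sequence have
    constant scalar products. *)
Lemma extension_sequence F (k : nat -> U -> R) s :
  (forall i, katetov F (k i)) -> Delta s -> 0 < s ->
  (forall i j x, x \in F -> k i x - k j x <= s <= k i x + k j x) ->
  exists a : nat -> U, (forall i x, x \in F -> mdist (a i) x = k i x) /\
    forall i j, i != j -> mdist (a i) (a j) = s.
Proof.
move=> hk Ds s0 hs.
have [_ hD hom univ] := hU.
pose T := (F + nat)%type.
pose d (p q : T) : R := match p, q with
  | inl x, inl y => mdist (val x) (val y)
  | inl x, inr i => k i (val x)
  | inr i, inl x => k i (val x)
  | inr i, inr j => if i == j then 0 else s
  end.
have kpos i (x : F) : 0 < k i (val x) by have [_ + _] := hk i; apply; exact: valP.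
have kkat i (x y : F) : k i (val x) - k i (val y) <= mdist (val x) (val y) <=
    k i (val x) + k i (val y).
  by have [_ _ +] := hk i; apply; exact: valP.
have hs' i j (x : F) : k i (val x) - k j (val x) <= s <= k i (val x) + k j (val x).
  by apply: hs; exact: valP.
have d0 p : d p p = 0 by case: p => [x|i] /=; rewrite ?mdistxx ?eqxx.
have dpos p q : d p q = 0 -> p = q.
  case: p q => [x|i] [y|j] /=.
  - by move=> /mdist_positivity/val_inj ->.
  - by move=> k0; have := kpos j x; rewrite k0 ltxx.
  - by move=> k0; have := kpos i y; rewrite k0 ltxx.
  - by have [-> //|_ s00] := eqVneq i j; move: s0; rewrite s00 ltxx.
have dC p q : d p q = d q p.
  by case: p q => [x|i] [y|j] //=; [rewrite metric_sym|rewrite eq_sym].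
have dtri q p r : d p r <= d p q + d q r.
  case: p q r => [x|i] [y|j] [z|l] /=.
  - exact: metric_triangle.
  - by have := kkat l x y; lra.
  - by have := kkat j x z; lra.
  - case: eqVneq => [->|_]; first by rewrite addr0.
    by have := hs' l j x; lra.
  - have := kkat i z y; rewrite (metric_sym (val z)); lra.
  - case: eqVneq => [->|_]; last by have := hs' i l y; lra.
    by have := kpos l y; lra.
  - case: eqVneq => [->|_]; first by rewrite add0r.
    by have := hs' i j z; lra.
  - have [->|ij] := eqVneq i j; first by rewrite add0r.
    have [<-|jl] := eqVneq j l; first by rewrite addr0 (negbTE ij).
    by case: ifP => _; lra.
have [M [e [esurj eM]]] := metric_of_distance d0 dpos dC dtri.
have cM : countable [set: M].
  have -> : [set: M] = e @` [set: T].
    by apply/seteqP; split=> // y _; have [x <-] := esurj y; exists x.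
  by apply: sub_countable; [exact: card_image_le|exact: countableP].
have dM : delta_metric Delta M.
  move=> x y; have [p <-] := esurj x; have [q <-] := esurj y; rewrite eM.
  case: p q => [p|i] [q|j] /=; first exact: hD.
  - by have [+ _ _] := hk j; apply; exact: valP.
  - by have [+ _ _] := hk i; apply; exact: valP.
  - by case: ifP => // _; exact: distance_set0.
have [f fM] := univ M cM dM.
pose phi (u : U) := if insub u is Some y then f (e (inl (y : F))) else u.
have phiE (x : F) : phi (val x) = f (e (inl x)) by rewrite /phi valK.
have [|x y xF yF|g gE] := @hom [set` F] phi.
- exact: finite_fset.
- have := phiE [` xF]%fset; have := phiE [` yF]%fset; rewrite /= => -> ->.
  by rewrite fM eM.
exists (fun i => (g^-1%g : isom U) (f (e (inr i)))); split=> [i x xF|i j ij].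
  rewrite -(isom_mdist g) isomKV gE//.
  by have := phiE [` xF]%fset; rewrite /= => ->; rewrite fM eM.
by rewrite isom_mdist fM eM /= (negbTE ij).
Qed.

Context (Dn0 : Delta <> [set 0]).

Lemma small_distance F k :
  (forall x, x \in F -> Delta (k x)) -> (forall x, x \in F -> 0 < k x) ->
  exists s, [/\ Delta s, 0 < s & forall x, x \in F -> s <= k x].
Proof.
move=> kD k0.
have [t [Dt t0]] : exists t, Delta t /\ 0 < t.
  apply: contrapT => /forallNP nt; apply: Dn0; apply/seteqP; split => [x Dx|_ ->].
    apply: contrapT => /= /eqP x0; apply: (nt x); split => //.
    rewrite lt_neqAle eq_sym x0 /=.
    exact: distance_set_ge0.
  exact: distance_set0.
pose s := \big[Num.min/t]_(x <- F) k x; exists s; split.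
- rewrite /s big_seq; apply: (big_ind Delta) => // x y Dx Dy.
  by rewrite /Num.min; case: ifP.
- rewrite /s big_seq; apply: (big_ind (fun z => 0 < z)) => // x y x0 y0.
  by rewrite lt_min x0.
- by move=> x xF; apply: ge_bigmin_seq => //; exists x.
Qed.

Lemma katetov_realized F k : katetov F k ->
  exists a, forall x, x \in F -> mdist a x = k x.
Proof.
move=> hk; have [kD k0 _] := hk.
have [s [Ds s0 sk]] := small_distance kD k0.
have [i j x xF|a [aE _]] := @extension_sequence F (fun=> k) s (fun=> hk) Ds s0.
  by rewrite subrr ltW//= (le_trans (sk _ xF))// lerDl ltW// k0.
by exists (a 0%N); exact: aE.
Qed.

Lemma transport_point F a p : (forall x, x \in F -> mdist p x = mdist a x) ->
  exists2 g : isom U, fixes g F & g a = p.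
Proof.
have [_ _ hom _] := hU; move=> pa.
have [||g gE] := @hom [set` (a |` F)%fset] (fun x => if x == a then p else x).
- exact: finite_fset.
- move=> x y; rewrite /= !in_fset1U.
  case: eqVneq => [->|_]; case: eqVneq => [->|_] //=; rewrite ?mdistxx//.
    by move=> _; exact: pa.
  by move=> xF _; rewrite metric_sym pa// metric_sym.
exists g => [x xF|]; last by rewrite gE /= ?eqxx// fset1U1.
rewrite gE /= ?in_fset1U ?xF ?orbT//; case: eqVneq => // xa.
by apply: mdist_positivity; rewrite pa// xa mdistxx.
Qed.

Lemma transport_pair F a b p q : (forall x, x \in F -> mdist p x = mdist a x) ->
  (forall x, x \in F -> mdist q x = mdist b x) -> mdist p q = mdist a b ->
  exists g : isom U, [/\ fixes g F, g a = p & g b = q].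
Proof.
move=> pa qb pq; have [g gF ga] := transport_point pa.
have [x|h hF hb] := @transport_point (p |` F)%fset (g b) q.
  rewrite in_fset1U => /orP[/eqP ->|xF].
    by rewrite metric_sym pq -ga isom_mdist metric_sym.
  by rewrite qb// -{2}(gF x xF) isom_mdist.
exists (h * g)%g; split=> [x xF||] /=; last exact: hb.
  by rewrite gF// hF// in_fset1U xF orbT.
by rewrite ga hF// fset1U1.
Qed.

Lemma move_point_off F B a : a \notin F ->
  exists2 g : isom U, fixes g F & g a \notin B.
Proof.
move=> aF; have hk := katetov_dist aF; have [kD k0 _] := hk.
have [s [Ds s0 sk]] := small_distance kD k0.
have [i j x xF|p [pE pp]] := @extension_sequence F (fun=> mdist a) s (fun=> hk) Ds s0.
  by rewrite subrr ltW//= (le_trans (sk _ xF))// lerDl ltW// k0.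
have pinj : injective p.
  move=> i j pij; apply/eqP; apply: contraT => /pp; rewrite pij mdistxx => s00.
  by move: s0; rewrite -s00 ltxx.
have [i pB] : exists i, p i \notin B.
  apply: contrapT => /forallNP pB.
  have : (size (map p (iota 0 (size B).+1)) <= size B)%N.
    apply: uniq_leq_size; first by rewrite map_inj_uniq ?iota_uniq.
    by move=> _ /mapP[i _ ->]; have /negP := pB i; rewrite negbK.
  by rewrite size_map size_iota ltnn.
have [x xF|g gF ga] := @transport_point F a (p i); first exact: pE.
by exists g => //; rewrite ga.
Qed.

(** A form of Neumann's lemma: the orbits outside [F] being infinite, move one
    point off [B], then continue with the stabiliser of its image. *)
Lemma move_points_off F B (s : seq U) : (forall x, x \in s -> x \notin F) ->
  exists2 g : isom U, fixes g F & forall x, x \in s -> g x \notin B.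
Proof.
have [n] := ubnP (size s); elim: n F s => // n IHn F [|x s] /= ltn sF.
  by exists 1%g.
have [|g gF gx] := @move_point_off F B x; first by apply: sF; exact: mem_head.
pose t := [seq g y | y <- s & y != x].
have [||h hF ht] := IHn (g x |` F)%fset t.
- by rewrite size_map size_filter (leq_ltn_trans (count_size _ _)).
- move=> _ /mapP[y + ->]; rewrite mem_filter => /andP[yx ys].
  rewrite in_fset1U negb_or (inj_eq (@isom_inj _ _ g)) yx /=.
  have := sF y; rewrite inE ys orbT => /(_ isT); apply: contraNN => gyF.
  by rewrite -(isomVK g y) (fixesV gF).
have hgx : h (g x) = g x by rewrite hF// fset1U1.
exists (h * g)%g => [y yF|y]; first by rewrite /= gF// hF// in_fset1U yF orbT.
rewrite inE /=; have [-> _|yx /= ys] := eqVneq y x; first by rewrite hgx.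
by apply: ht; apply: map_f; rewrite mem_filter yx.
Qed.

End Extension.
Arguments katetov {R} Delta {U} F k.

(** * Vectors fixed by different stabilisers *)

Section Orthogonality.
Context {R : realType} {H : hilbertSpace R}.

(** Bessel's inequality forbids infinitely many equal nonzero coefficients. *)
Lemma rdot_orthogonal_sequence (w : nat -> H) (y : H) (kappa delta : R) :
  (forall i j, i != j -> rdot (w i) (w j) = 0) ->
  (forall i, nrm (w i) ^+ 2 = kappa) -> (forall i, rdot (w i) y = delta) ->
  delta = 0.
Proof.
move=> worth wnorm wy.
have bessel N : N%:R * delta ^+ 2 <= kappa * nrm y ^+ 2.
  have := sqr_ge0 (nrm (\sum_(i < N) (delta%:C%C *: w i) - (kappa%:C%C *: y))).
  have -> : nrm (\sum_(i < N) (delta%:C%C *: w i) - kappa%:C%C *: y) ^+ 2 =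
      N%:R * (delta ^+ 2 * kappa) + kappa ^+ 2 * nrm y ^+ 2
      - 2 * (N%:R * (kappa * delta ^+ 2)).
    rewrite sqr_nrmB nrmZ exprMn real_normK ?num_real//.
    congr (_ + _ - 2 * _).
      rewrite -rdotxx rdot_suml (eq_bigr (fun=> delta ^+ 2 * kappa)) => [|i _].
        by rewrite sumr_const card_ord mulr_natl.
      rewrite rdot_sumr (bigD1 i)//= big1 => [|j ji].
        by rewrite rdotZl rdotZr rdotxx wnorm addr0; ring.
      rewrite rdotZl rdotZr worth ?mulr0//.
      by apply: contra ji => /eqP/ord_inj ->.
    rewrite rdot_suml (eq_bigr (fun=> kappa * delta ^+ 2)) => [|i _].
      by rewrite sumr_const card_ord mulr_natl.
    by rewrite rdotZl rdotZr wy; ring.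
  have [k0|k0] := eqVneq kappa 0.
    have w0 i : w i = 0.
      by apply/nrm_eq0/eqP; rewrite -sqrf_eq0 wnorm k0 eqxx.
    by move=> _; rewrite -(wy 0%N) w0 rdot0l k0 expr0n /= mulr0 mul0r lexx.
  have kpos : 0 < kappa by rewrite lt_neqAle eq_sym k0 -(wnorm 0%N) sqr_ge0.
  set D := delta ^+ 2; set Y := nrm y ^+ 2.
  have -> : N%:R * (D * kappa) + kappa ^+ 2 * Y - 2 * (N%:R * (kappa * D)) =
    kappa * (kappa * Y - N%:R * D) by ring.
  by rewrite pmulr_rge0// subr_ge0.
apply/eqP; rewrite -sqrf_eq0; apply/eqP.
apply/eqP; rewrite eq_le sqr_ge0 andbT leNgt; apply/negP => d0.
pose N := (Num.trunc (kappa * nrm y ^+ 2 / delta ^+ 2)).+1.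
have := bessel N; apply/negP; rewrite -ltNge -ltr_pdivrMr//.
exact: truncnS_gt.
Qed.

(** A sequence with constant off-diagonal Gram coefficients converges weakly,
    so its scalar products with [y] cannot take two values infinitely often. *)
Lemma rdot_alternating (v : nat -> H) (y : H) (c g u0 u1 : R) :
  (forall i j, i != j -> rdot (v i) (v j) = g) ->
  (forall i, nrm (v i) ^+ 2 = c) ->
  (forall i, rdot (v i.*2) y = u0) -> (forall i, rdot (v i.*2.+1) y = u1) ->
  u0 = u1.
Proof.
move=> vg vc v0 v1; apply/eqP; rewrite -subr_eq0; apply/eqP.
have neq i : i.*2 != i.*2.+1 by rewrite neq_ltn ltnSn.
apply: (@rdot_orthogonal_sequence (fun i => v i.*2 - v i.*2.+1) y (2 * c - 2 * g)).
- move=> i j ij; rewrite rdotBl !rdotBr !vg ?subrr//.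
  + by rewrite eqSS (inj_eq double_inj).
  + by rewrite eq_sym; apply/eqP => /(congr1 odd); rewrite /= !odd_double.
  + by apply/eqP => /(congr1 odd); rewrite /= !odd_double.
  + by rewrite (inj_eq double_inj).
- by move=> i; rewrite sqr_nrmB !vc vg//; ring.
- by move=> i; rewrite rdotBl v0 v1.
Qed.

End Orthogonality.

Section Dissociation.
Context {R : realType} {Delta : set R} {U : metricType R} {H : hilbertSpace R}.
Context (hDelta : distance_set Delta) (hU : urysohn_space Delta U).
Context (Dn0 : Delta <> [set 0]) (pi : unitaryRep (isom U) H).

Section Coefficient.
Context (E B : {fset U}) (a : U) (x y : H).
Context (EB : (E `<=` B)%fset).
Context (fx : fixed pi (a |` E)%fset x) (fy : fixed pi B y).

Let phi (h : isom U) : R := rdot (pi h x) y.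

Let realizes (h : isom U) (k : U -> R) : Prop :=
  fixes h E /\ forall b, b \in B -> mdist (h a) b = k b.

(** The vector [pi h x] only depends on the restriction of [h] to [a |` E], and
    translating it by the stabiliser of [B] does not affect its product with
    [y]. *)
Let realizes_eq h h' k : realizes h k -> realizes h' k -> phi h = phi h'.
Proof.
move=> [hE hk] [h'E h'k].
have [b bB|g gB ga] := transport_point hU (F := B) (a := h a) (p := h' a).
  by rewrite hk// h'k.
rewrite /phi; have -> : pi h' x = pi (g * h)%g x.
  apply: (fixed_eq fx) => e; rewrite in_fset1U => /orP[/eqP->|eE] /=.
    by rewrite ga.
  by rewrite hE// h'E// gB// (fsubsetP EB).
by rewrite repM [RHS]rep_adj fy//; exact: fixesV.
Qed.

Let agrees (k : U -> R) : Prop :=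
  katetov Delta B k /\ forall e, e \in E -> k e = mdist a e.

Let realizes_ex k : agrees k -> exists h, realizes h k.
Proof.
move=> [hk kE]; have [p pk] := katetov_realized hDelta hU Dn0 hk.
have [e eE|h hE ha] := transport_point hU (F := E) (a := a) (p := p).
  by rewrite pk ?kE// (fsubsetP EB).
by exists h; split => // b bB; rewrite ha pk.
Qed.

(** Points realising [k] and points realising [k'] alternate in a sequence of
    points mutually at distance [s]; all pairs of its points are conjugate over
    [E], which makes the Gram coefficients constant. *)
Let coefficient_close k k' s h h' : agrees k -> agrees k' -> Delta s -> 0 < s ->
  (forall b, b \in B ->
    [/\ k b - k' b <= s, k' b - k b <= s, s <= k b & s <= k' b]) ->
  realizes h k -> realizes h' k' -> phi h = phi h'.
Proof.
move=> [kk kE] [kk' kE'] Ds s0 ks rk rk'.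
pose K i := if odd i then k' else k.
have [|i j b bB|p [pK ps]] := extension_sequence hDelta hU (F := B) (k := K) _ Ds s0.
- by move=> i; rewrite /K; case: ifP.
- by have [] := ks b bB; rewrite /K; case: ifP; case: ifP => _ _ ? ? ? ?; lra.
have pE i e : e \in E -> mdist (p i) e = mdist a e.
  by move=> eE; rewrite pK ?(fsubsetP EB)// /K; case: ifP => _; rewrite ?kE ?kE'.
have gex i : exists g : isom U, fixes g E /\ g a = p i.
  by have [g gE ga] := transport_point hU (pE i); exists g.
have [g gP] := choice gex.
apply: (@rdot_alternating _ _ (fun i => pi (g i) x) y (nrm x ^+ 2)
  (rdot (pi (g 0%N) x) (pi (g 1%N) x))) => [i j ij|i|i|i]; rewrite ?rep_nrm//.
- have [e eE|e eE||f [fE f0 f1]] := transport_pair hU (F := E) (a := p 0%N)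
    (b := p 1%N) (p := p i) (q := p j).
  + by rewrite !pE.
  + by rewrite !pE.
  + by rewrite !ps.
  have fg l m : f (p l) = p m -> pi (g m) x = pi f (pi (g l) x).
    have [glE gla] := gP l; have [gmE gma] := gP m.
    move=> flm; rewrite -repM; apply: (fixed_eq fx) => e.
    rewrite in_fset1U => /orP[/eqP->|eE] /=; first by rewrite gla gma.
    by rewrite gmE// glE// fE.
  by rewrite (fg _ _ f0) (fg _ _ f1) rep_rdot.
- apply: (@realizes_eq _ _ k) => //; have [gE ga] := gP i.*2; split=> // b bB.
  by rewrite ga pK// /K odd_double.
- apply: (@realizes_eq _ _ k') => //; have [gE ga] := gP i.*2.+1; split=> // b bB.
  by rewrite ga pK// /K /= odd_double.
Qed.

(** The functions [min (k + j s) k'] lead from [k] to [k'] in steps to which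
    the previous lemma applies. *)
Let coefficient_mono k k' h h' : agrees k -> agrees k' ->
  (forall b, b \in B -> k b <= k' b) ->
  realizes h k -> realizes h' k' -> phi h = phi h'.
Proof.
move=> ak ak' kk' rk rk'; have [[kD k0 kd] kE] := ak; have [[kD' k0' kd'] kE'] := ak'.
have [s [Ds s0 sk]] := small_distance hDelta Dn0 kD k0.
pose K j b := Num.min (k b + j%:R * s) (k' b).
have Kk j b : b \in B -> k b <= K j b.
  by move=> bB; rewrite le_min kk'// lerDl mulr_ge0 ?ler0n// ltW.
have aK j : agrees (K j).
  split=> [|e eE]; last first.
    rewrite /K kE ?kE'//; apply/min_idPr; rewrite lerDl mulr_ge0 ?ler0n//.
    exact: ltW.
  split=> [b bB|b bB|b c bB cB].
  - rewrite /K; elim: j => [|j IHj].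
      by rewrite mul0r addr0 /Num.min; case: ifP => _; [exact: kD|exact: kD'].
    have [le|_] := leP _ (k' b); last exact: kD'.
    have le' : k b + j%:R * s <= k' b.
      by apply: le_trans le; rewrite lerD2l ler_pM2r// ler_nat.
    move: IHj; rewrite (min_idPl le') => IHj.
    rewrite -natr1 mulrDl mul1r addrA.
    apply: (distance_setD hDelta IHj Ds (kD' b bB)).
    by rewrite -addrA -{2}[s]mul1r -mulrDl natr1.
  - by apply: lt_le_trans (Kk j b bB); exact: k0.
  - have /andP[d1 d2] := kd _ _ bB cB; have /andP[d1' d2'] := kd' _ _ bB cB.
    have := Kk j b bB; have := Kk j c cB; rewrite /K.
    by case: (leP _ (k' b)) => ?; case: (leP _ (k' c)) => ? ? ?; lra.
have chain j : forall g, realizes g (K j) -> phi h = phi g.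
  elim: j => [|j IHj] g rg.
    apply: realizes_eq rk _; have [gE gK] := rg; split=> // b bB.
    by rewrite gK// /K mul0r addr0; apply/min_idPl; exact: kk'.
  have [f rf] := realizes_ex (aK j); rewrite (IHj f rf).
  apply: (coefficient_close (aK j) (aK j.+1) Ds s0 _ rf rg) => b bB.
  have := sk b bB; have := Kk j b bB; have := Kk j.+1 b bB.
  rewrite /K -(natr1 j) mulrDl mul1r.
  by case: (leP (k b + j%:R * s) (k' b)) => ?;
    case: (leP (k b + (j%:R * s + s)) (k' b)) => ? ? ? ?; split; lra.
have [N hN] : exists N : nat, forall b, b \in B -> k' b <= k b + N%:R * s.
  exists (\max_(b <- B) (Num.trunc ((k' b - k b) / s)).+1) => b bB.
  rewrite -lerBlDl -ler_pdivrMr//; apply: (le_trans (ltW (truncnS_gt _))).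
  rewrite ler_nat.
  by apply: (leq_bigmax_seq (F := fun b => (Num.trunc ((k' b - k b) / s)).+1)).
apply: (chain N h'); have [hE hk'] := rk'; split=> // b bB.
by rewrite hk'// /K; apply/esym/min_idPr; exact: hN.
Qed.

(** The maximum of two distance functions is again one, and dominates both. *)
Lemma coefficient_const g h : fixes g E -> fixes h E ->
  g a \notin B -> h a \notin B -> rdot (pi g x) y = rdot (pi h x) y.
Proof.
move=> gE hE gB hB.
have ag f : fixes f E -> f a \notin B -> agrees (mdist (f a)).
  move=> fE fB; split; first exact: katetov_dist.
  by move=> e eE; rewrite -{1}(fE e eE) isom_mdist.
pose K b := Num.max (mdist (g a) b) (mdist (h a) b).
have aK : agrees K.
  have [[gD g0 gd] gE'] := ag g gE gB; have [[hD h0 hd] hE'] := ag h hE hB.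
  split=> [|e eE]; last by rewrite /K gE'// hE'// maxxx.
  split=> [b bB|b bB|b c bB cB]; rewrite /K.
  - by case: leP => _; [exact: hD|exact: gD].
  - by rewrite lt_max g0.
  - have /andP[d1 d2] := gd _ _ bB cB; have /andP[d1' d2'] := hd _ _ bB cB.
    by case: (leP (mdist (g a) b)) => ?; case: (leP (mdist (g a) c)) => ?; lra.
have [f rf] := realizes_ex aK.
apply: (@etrans _ _ (phi f)).
  apply: (coefficient_mono (ag g gE gB) aK _ _ rf) => // b bB.
  by rewrite le_max lexx.
apply/esym; apply: (coefficient_mono (ag h hE hB) aK _ _ rf) => // b bB.
by rewrite le_max lexx orbT.
Qed.

End Coefficient.

(** As [x] is orthogonal to the vectors fixed by the stabiliser of [E], the
    closed hull of its orbit contains [0], so averages of translates [pi h x]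
    can be arbitrarily small. A further translation moves all the points [h a]
    off [B], and the coefficient of the average against [y] is then that of
    [x]. *)
Lemma dissociation (E B : {fset U}) a x y : a \notin B ->
  fixed pi (a |` E)%fset x -> (forall z, fixed pi E z -> rdot x z = 0) ->
  (E `<=` B)%fset -> fixed pi B y -> rdot x y = 0.
Proof.
move=> aB fx xE EB fy.
have aE : a \notin E by apply: contra aB; exact: (fsubsetP EB).
have [p fp adh] := orbit_hull_fixed pi E x.
have p0 : p = 0.
  apply: nrm_eq0; apply/eqP; rewrite -sqrf_eq0 -rdotxx eq_le.
  rewrite {2}rdotxx sqr_ge0 andbT; apply/ler_addgt0Pr => e e0; rewrite add0r.
  have d0 : 0 < e / (nrm p + 1) by rewrite divr_gt0// ltr_wpDl// nrm_ge0.
  have [s Ss sp] := adh _ d0.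
  have -> : rdot p p = rdot (p - s) p.
    by rewrite rdotBl (orbit_hull_rdot fp Ss) xE// subr0.
  apply: (le_trans (rdot_le _ _)); rewrite nrm_distC.
  have np := nrm_ge0 p; have ns := nrm_ge0 (s - p).
  rewrite ltr_pdivlMr in sp; last by lra.
  by apply: le_trans (ltW sp); rewrite ler_wpM2l// lerDl.
have coef u : orbit_hull pi E x u ->
    exists s : seq U, (forall b, b \in s -> b \notin E) /\
      forall k : isom U, fixes k E -> (forall b, b \in s -> k b \notin B) ->
      rdot (pi k u) y = rdot x y.
  elim=> [h hE|u1 u2 _ [s1 [s1E Hs1]] _ [s2 [s2E Hs2]]].
    exists [:: h a]; split=> [b|k kE /(_ (h a))].
      rewrite inE => /eqP->; apply: contra aE => haE.
      by rewrite -(isomVK h a) (fixesV hE).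
    rewrite mem_head => /(_ isT) khB; rewrite -repM -{2}[x](rep1 pi).
    by apply: (coefficient_const EB fx fy) => //; exact: fixesM.
  exists (s1 ++ s2); split=> [b|k kE ks].
    by rewrite mem_cat => /orP[/s1E|/s2E].
  rewrite rep_midpoint /midpoint rdotZl rdotDl Hs1 ?Hs2//; first by field.
    by move=> b bs; apply: ks; rewrite mem_cat bs orbT.
  by move=> b bs; apply: ks; rewrite mem_cat bs.
apply/eqP; rewrite -normr_eq0 eq_le normr_ge0 andbT.
apply/ler_addgt0Pr => e e0; rewrite add0r.
have d0 : 0 < e / (nrm y + 1) by rewrite divr_gt0// ltr_wpDl// nrm_ge0.
have [u Su] := adh _ d0; rewrite p0 subr0 => ue.
have [s [sE Hs]] := coef _ Su.
have [k kE ks] := move_points_off hDelta hU Dn0 B sE.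
rewrite -(Hs k kE ks); apply: (le_trans (normr_rdot_le _ _)); rewrite rep_nrm.
have ny := nrm_ge0 y; have nu := nrm_ge0 u.
rewrite ltr_pdivlMr in ue; last by lra.
by apply: le_trans (ltW ue); rewrite ler_wpM2l// lerDl.
Qed.

End Dissociation.

(** * The decomposition into pure parts *)

Section PureVectors.
Context {R : realType} {Delta : set R} {U : metricType R} {H : hilbertSpace R}.
Context (hDelta : distance_set Delta) (hU : urysohn_space Delta U).
Context (Dn0 : Delta <> [set 0]) (pi : unitaryRep (isom U) H).
Implicit Types (A B D : {fset U}) (x y z : H).

(** What the stabiliser of [A] fixes beyond what smaller sets account for. *)
Definition pure A x : Prop :=
  fixed pi A x /\ forall D y, (D `<` A)%fset -> fixed pi D y -> rdot x y = 0.

Lemma pure0 A : pure A 0.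
Proof. by split=> [|D y _ _]; [exact: fixed0|exact: rdot0l]. Qed.

Lemma pure_closed A : closed_subspace (pure A).
Proof.
split=> [|x y [fx ox] [fy oy]|r x [fx ox]|p adh].
- exact: pure0.
- by split=> [|D z DA fz]; [exact: fixedD|rewrite rdotDl (ox D)// (oy D)// addr0].
- by split=> [|D z DA fz]; [exact: fixedZ|rewrite rdotZl (ox D)// mulr0].
- split=> [|D z DA fz].
    apply: fixed_adherent => e e0; have [s [fs _] sp] := adh e e0.
    by exists s.
  apply/eqP; rewrite -normr_eq0 eq_le normr_ge0 andbT.
  apply/ler_addgt0Pr => e e0; rewrite add0r.
  have nz := nrm_ge0 z.
  have d0 : 0 < e / (nrm z + 1) by rewrite divr_gt0// ltr_wpDl.
  have [s [_ os] sp] := adh _ d0.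
  have -> : rdot p z = - rdot (s - p) z by rewrite rdotBl (os D)// sub0r opprK.
  rewrite normrN; apply: (le_trans (normr_rdot_le _ _)).
  rewrite ltr_pdivlMr in sp; last by rewrite ltr_wpDl.
  by apply: le_trans (ltW sp); rewrite ler_wpM2l ?nrm_ge0// lerDl.
Qed.

Lemma pure_rep A (g : isom U) x : pure A x -> pure [fset g a | a in A]%fset (pi g x).
Proof.
move=> [fx ox]; split=> [|D y DA fy]; first exact: fixed_rep.
rewrite rep_adj; apply: (ox [fset (g^-1%g : isom U) a | a in D]%fset); last first.
  exact: fixed_rep.
move: DA; rewrite !fproperEcard => /andP[DA cDA].
apply/andP; split.
  apply/fsubsetP => _ /imfsetP[b bD ->]; have /imfsetP[a aA ->] := fsubsetP DA b bD.
  by rewrite isomVK.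
rewrite card_imfset; last exact: isom_inj.
by rewrite (leq_trans cDA)// card_imfset//; exact: isom_inj.
Qed.

Lemma pure_fset0 x : pure fset0 x -> forall g, pi g x = x.
Proof. by move=> [fx _] g; apply: fx => a; rewrite in_fset0. Qed.

(** If [a] is in [A] and not in [B], then [x] is orthogonal to what is fixed
    over [A] without [a], and dissociation applies there. *)
Lemma pure_orthogonal A B x y : A <> B -> pure A x -> pure B y -> rdot x y = 0.
Proof.
suff half A' B' x' y' a : a \in A' -> a \notin B' -> pure A' x' -> pure B' y' ->
    rdot x' y' = 0.
  move=> AB px py; have [AsB|/fsubsetPn[a aA aB]] := boolP (A `<=` B)%fset.
    have [BsA|/fsubsetPn[b bB bA]] := boolP (B `<=` A)%fset.
      by case: AB; apply/eqP; rewrite eqEfsubset AsB.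
    by rewrite rdotC; exact: (half _ _ _ _ b bB bA py px).
  exact: (half _ _ _ _ a aA aB px py).
move=> aA aB [fx ox] [fy oy].
apply: (@dissociation _ _ _ _ hDelta hU Dn0 pi (A' `\ a)%fset (A' `\ a `|` B')%fset a).
- by rewrite in_fsetU in_fsetD1 eqxx.
- by rewrite fsetD1K.
- by move=> z; apply: ox; exact: fproperD1.
- exact: fsubsetUl.
- by apply: fixedS fy; exact: fsubsetUr.
Qed.

(** Subtract from [x] its projections on the pure spaces of the proper subsets
    of [A]. The decomposition of vectors fixed over such subsets, known by
    induction, shows that the remainder is pure. *)
Lemma pure_decomposition A x : fixed pi A x ->
  exists f : {fset U} -> H, (forall B, pure B (f B)) /\
    x = \sum_(B <- fpowerset A) f B.
Proof.
have [n] := ubnP #|` A|; elim: n A x => // n IHn A x ltn fx.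
have pex B : exists k, pure B k /\ forall z, pure B z -> rdot (x - k) z = 0.
  by have [k pk ok] := projection_ex x (pure_closed B); exists k.
have [p pP] := choice pex.
pose y := x - \sum_(B <- fpowerset A | B != A) p B.
exists (fun B => if B == A then y else p B); split; last first.
  rewrite (bigD1_seq A)/= ?fset_uniq ?fpowersetE ?fsubset_refl// eqxx.
  rewrite [X in _ + X](eq_bigr p) => [|B /negbTE->//].
  by rewrite /y subrK.
move=> B; case: eqVneq => [->|_]; last by have [] := pP B.
have fy : fixed pi A y.
  apply: fixedD => //; apply: fixedN.
  rewrite big_seq_cond; apply: (big_ind (fixed pi A)); first exact: fixed0.
    by move=> *; exact: fixedD.
  move=> B' /andP[]; rewrite fpowersetE => BA _.
  by have [[fp _] _] := pP B'; exact: fixedS fp.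
split=> // D z DA fz.
have [DsA cD] : (D `<=` A)%fset /\ (#|` D| < n)%N.
  split; first exact: fproper_sub.
  by rewrite (leq_trans (fproper_ltn_card DA)).
have [f [pf ->]] := IHn D z cD fz.
rewrite rdot_sumr big_seq big1// => B'; rewrite fpowersetE => B'D.
have B'A : B' != A.
  by apply: contraTneq DA => <-; rewrite fproperE B'D andbF.
have B'pA : B' \in fpowerset A by rewrite fpowersetE (fsubset_trans B'D).
rewrite /y rdotBl rdot_suml -big_filter (bigD1_seq B')/= ?filter_uniq ?fset_uniq//; last first.
  by rewrite mem_filter B'A.
rewrite big1 ?addr0 => [|C CB']; last first.
  by have [pC _] := pP C; apply: pure_orthogonal pC (pf B'); exact/eqP.
by rewrite -rdotBl; have [_ ->] := pP B'.
Qed.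

End PureVectors.

(** * The spectral bound *)

Section Kesten.
Context {R : realType} {T : eqType} {m : nat}.
Context (g : 'I_m -> T -> T) (L : seq T) (out : 'I_m * bool -> T -> bool).
Context (g_inj : forall i, injective (g i)) (uL : uniq L) (m0 : (0 < m)%N).
Context (out_deg : forall x, x \in L -> (\sum_l out l x <= 1)%N).
Context (out_edge : forall i x, x \in L -> out (i, true) x || out (i, false) (g i x)).
Context (f : T -> R) (f0 : forall x, 0 <= f x).

Let c : R := Num.sqrt (2 * m%:R - 1).

Let m1 : 1 <= m%:R :> R. Proof. by rewrite ler1n. Qed.

Let c2 : c ^+ 2 = 2 * m%:R - 1.
Proof. by rewrite sqr_sqrtr//; have := m1; lra. Qed.

Let c_gt0 : 0 < c. Proof. by rewrite sqrtr_gt0; have := m1; lra. Qed.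

Let c1 : 1 <= c.
Proof.
rewrite -ler_sqr ?nnegrE ?ler01 ?(ltW c_gt0)// expr1n c2.
by have := m1; lra.
Qed.

Let w (l : 'I_m * bool) (x : T) : R := if out l x then c / 2 else (2 * c)^-1.

Let w_ge0 l x : 0 <= w l x.
Proof.
by rewrite /w; case: ifP => _; rewrite ?divr_ge0 ?invr_ge0 ?mulr_ge0// ltW.
Qed.

Let w_edge i x : x \in L ->
  f x * f (g i x) <= w (i, true) x * f x ^+ 2 + w (i, false) (g i x) * f (g i x) ^+ 2.
Proof.
move=> xL; have := out_edge i xL; rewrite /w.
set a := f x; set b := f (g i x).
have ic : c * c^-1 = 1 by rewrite divff// gt_eqF.
have ic0 : 0 < c^-1 by rewrite invr_gt0.
have ic1 : c^-1 <= 1 by rewrite invf_le1.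
have amgm u v : u * v <= c / 2 * u ^+ 2 + (2 * c)^-1 * v ^+ 2.
  rewrite invfM -subr_ge0.
  have -> : c / 2 * u ^+ 2 + 2^-1 / c * v ^+ 2 - u * v =
      c^-1 / 2 * (c * u - v) ^+ 2.
    by field; rewrite gt_eqF.
  by rewrite mulr_ge0 ?sqr_ge0 ?divr_ge0// ltW.
have a2 := sqr_ge0 a; have b2 := sqr_ge0 b.
have amgm' := amgm b a; have amgm'' := amgm a b.
case: ifP => _; case: ifP => _ // _; last by rewrite mulrC addrC.
apply: le_trans amgm'' _; rewrite lerD2l ler_wpM2r//.
by rewrite invfM; have := c1; nra.
Qed.

Let w_sum x : x \in L -> \sum_l w l x <= c.
Proof.
move=> xL; have ic0 : 0 < c^-1 by rewrite invr_gt0.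
have ic1 : c^-1 <= 1 by rewrite invf_le1.
rewrite (eq_bigr (fun l => (2 * c)^-1 + (out l x)%:R * (c / 2 - (2 * c)^-1))); last first.
  by move=> l _; rewrite /w; case: (out l x); rewrite /= ?mul1r ?mul0r ?addr0 ?subrKC.
rewrite big_split /= sumr_const card_prod card_ord card_bool -mulr_suml -natr_sum.
have := out_deg xL; rewrite -(ler_nat R); set d := _%:R => d1.
have k0 : 0 <= c / 2 - (2 * c)^-1 by rewrite invfM; have := c1; lra.
have := ler_wpM2r k0 d1; rewrite mul1r => h.
rewrite -[X in X + _]mulr_natl natrM.
have e : m%:R * 2%:R * (2 * c)^-1 + (c / 2 - (2 * c)^-1) = c.
  have -> : m%:R * 2%:R = c ^+ 2 + 1 by rewrite c2; ring.
  by field; rewrite gt_eqF.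
by rewrite -[leRHS]e lerD2l.
Qed.

(** In a [2m]-regular graph oriented with out-degree at most one, weigh the
    origin of each edge by [c / 2] and its end by [1 / (2 c)]; the weights
    around a vertex then add up to at most [c]. *)
Lemma kesten_bound :
  \sum_(i < m) \sum_(x <- L | g i x \in L) f x * f (g i x) <=
  c * \sum_(x <- L) f x ^+ 2.
Proof.
have reidx i (h : T -> R) : (forall x, 0 <= h x) ->
    \sum_(x <- L | g i x \in L) h (g i x) <= \sum_(x <- L) h x.
  move=> h0; rewrite -big_filter -(big_map (g i) xpredT h).
  set L' := map _ _.
  have uL' : uniq L' by rewrite map_inj_uniq// filter_uniq.
  have L'L : {subset L' <= L}.
    by move=> _ /mapP[x + ->]; rewrite mem_filter => /andP[].
  rewrite [leRHS](bigID (mem L'))/= -[in leRHS]big_filter.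
  have pL : perm_eq [seq x <- L | x \in L'] L'.
    apply: uniq_perm; rewrite ?filter_uniq// => x; rewrite mem_filter.
    by case: (boolP (x \in L')) => //= /L'L.
  by rewrite (perm_big _ pL) /= lerDl sumr_ge0.
have step i : \sum_(x <- L | g i x \in L) f x * f (g i x) <=
    \sum_(x <- L) w (i, true) x * f x ^+ 2 + \sum_(x <- L) w (i, false) x * f x ^+ 2.
  apply: (@le_trans _ _ (\sum_(x <- L | g i x \in L)
      (w (i, true) x * f x ^+ 2 + w (i, false) (g i x) * f (g i x) ^+ 2))).
    by rewrite big_seq_cond [leRHS]big_seq_cond; apply: ler_sum => x /andP[xL _]; exact: w_edge.
  rewrite big_split /=; apply: lerD.
    rewrite [leRHS](bigID (fun x => g i x \in L))/= lerDl sumr_ge0// => x _.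
    by rewrite mulr_ge0 ?sqr_ge0.
  by apply: (reidx i (fun x => w (i, false) x * f x ^+ 2)) => x; rewrite mulr_ge0 ?sqr_ge0.
apply: (le_trans (ler_sum _ (fun i _ => step i))).
have -> : \sum_(i < m) (\sum_(x <- L) w (i, true) x * f x ^+ 2 +
      \sum_(x <- L) w (i, false) x * f x ^+ 2) =
    \sum_(x <- L) (\sum_l w l x) * f x ^+ 2.
  have sum_label (F : 'I_m * bool -> R) :
      \sum_l F l = \sum_(i < m) (F (i, true) + F (i, false)).
    rewrite (eq_bigr (fun l => F (l.1, l.2))) => [|[]//].
    rewrite -(pair_bigA _ (fun i b => F (i, b))) /=.
    by apply: eq_bigr => i _; rewrite big_bool.
  under eq_bigr do rewrite -big_split /=.
  rewrite exchange_big /=; apply: eq_bigr => x _.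
  by rewrite sum_label mulr_suml; apply: eq_bigr => i _; rewrite mulrDl.
rewrite mulr_sumr big_seq [leRHS]big_seq; apply: ler_sum => x xL.
by rewrite ler_wpM2r ?sqr_ge0// w_sum.
Qed.

End Kesten.

(** * The growing forest *)

Section Growth.
Context {R : realType} {U : metricType R} {m : nat}.

Definition generator (g : 'I_m -> isom U) (l : 'I_m * bool) : isom U :=
  if l.2 then g l.1 else (g l.1)^-1%g.

Definition inv_label (l : 'I_m * bool) : 'I_m * bool := (l.1, ~~ l.2).

Lemma inv_labelK : involutive inv_label.
Proof. by case=> i b; rewrite /inv_label /= negbK. Qed.

Lemma generator_inv g l x : generator g (inv_label l) (generator g l x) = x.
Proof. by case: l => i []; rewrite /generator /= ?isom_funK ?isom_inv_funK. Qed.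

(** The graph with edges [x -- g i x] grows one edge at a time: [time l x] is
    the date of the edge labelled [l] at [x], and [fresh l x] holds when its end
    [x] was isolated until then. The point [x0] is in the graph from the
    beginning. *)
Record growth (g : 'I_m -> isom U) (time : 'I_m * bool -> U -> nat)
    (fresh : 'I_m * bool -> U -> bool) (x0 : U) : Prop := Growth {
  time_inv : forall l x, time (inv_label l) (generator g l x) = time l x ;
  fresh_inv : forall l x, fresh (inv_label l) (generator g l x) = ~~ fresh l x ;
  fresh_first : forall l l' x, fresh l x -> l' != l -> (time l x < time l' x)%N ;
  fresh_root : forall l, ~~ fresh l x0
}.

Context {g : 'I_m -> isom U} {time : 'I_m * bool -> U -> nat}.
Context {fresh : 'I_m * bool -> U -> bool} {x0 : U}.
Hypothesis gr : growth g time fresh x0.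
Implicit Types (A B : {fset U}).

Lemma fresh_uniq l l' x : fresh l x -> fresh l' x -> l = l'.
Proof.
move=> fl fl'; apply/eqP; apply: contraT => ll'.
have := fresh_first gr fl'  ll'; have := fresh_first gr fl (l' := l').
by rewrite eq_sym ll' => /(_ isT) h h'; have := ltn_trans h h'; rewrite ltnn.
Qed.

(** An edge between finite sets is a bundle of edges between points; a latest
    one of them decides on its orientation. *)
Definition leaves l B : bool :=
  has (fun x => fresh l x && all (fun y => (time l y <= time l x)%N) B) B.

(** If the labels differ, the fresh points [x] and [y] deciding on them give
    [time l' y >= time l' x > time l x >= time l y > time l' y]. *)
Lemma leaves_uniq l l' B : leaves l B -> leaves l' B -> l = l'.
Proof.
move=> /hasP[x xB /andP[fx /allP mx]] /hasP[y yB /andP[fy /allP my]].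
apply/eqP; apply: contraT => ll'.
have xl := fresh_first gr fx (l' := l'); have yl := fresh_first gr fy ll'.
rewrite eq_sym ll' in xl.
have := leq_ltn_trans (my x xB) (leq_trans yl (mx y yB)).
by move=> h; have := ltn_trans h (xl isT); rewrite ltnn.
Qed.

Lemma leaves_edge l B : B != fset0 ->
  leaves l B || leaves (inv_label l) [fset generator g l x | x in B]%fset.
Proof.
move=> /fset0Pn[b bB].
have [x [xB mx]] : exists x, x \in B /\ forall y, y \in B -> (time l y <= time l x)%N.
  pose P n := has (fun y => time l y == n) B.
  have Pex : exists n, P n by exists (time l b); apply/hasP; exists b.
  have Pub n : P n -> (n <= \max_(y <- B) time l y)%N.
    by move=> /hasP[y yB /eqP <-]; exact: leq_bigmax_seq.
  case: (ex_maxnP Pex Pub) => n /hasP[x xB /eqP <-] nmax; exists x; split=> // y yB.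
  by apply: nmax; apply/hasP; exists y.
case: (boolP (fresh l x)) => fx; apply/orP; [left|right].
  by apply/hasP; exists x => //; rewrite fx; exact/allP.
apply/hasP; exists (generator g l x); first by rewrite in_imfset.
rewrite (fresh_inv gr) fx; apply/allP => _ /imfsetP[y yB ->].
by rewrite !(time_inv gr) mx.
Qed.

(** If [g i = g j], the edges labelled [i] and [j] at [x0] have the same ends,
    and the fresh end of either makes it strictly older than the other. *)
Lemma growth_inj : injective g.
Proof.
move=> i j gij; apply/eqP; apply: contraT => ij.
pose l := (i, true); pose l' := (j, true).
have genE x : generator g l x = generator g l' x by rewrite /generator /= gij.
have key (k k' : 'I_m * bool) x : k != k' -> generator g k x = generator g k' x ->
    (time k x < time k' x)%N.
  move=> kk' e; case: (boolP (fresh k x)) => fx.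
    by apply: (fresh_first gr) => //; rewrite eq_sym.
  rewrite -(time_inv gr k) -(time_inv gr k') -e.
  apply: (fresh_first gr); first by rewrite (fresh_inv gr).
  by rewrite (inj_eq (can_inj inv_labelK)) eq_sym.
have ll' : l != l' by rewrite /l xpair_eqE (negbTE ij).
have h := key _ _ x0 ll' (genE x0).
have h' := key l' l x0; rewrite eq_sym ll' genE in h'.
by have := ltn_trans h (h' isT erefl); rewrite ltnn.
Qed.

End Growth.
Arguments leaves {R U m} time fresh l B.

Section GrowthOrbits.
Context {R : realType} {U : metricType R} {m : nat}.
Context {g : 'I_m -> isom U} {time : 'I_m * bool -> U -> nat}.
Context {fresh : 'I_m * bool -> U -> bool} {x0 : U}.
Hypothesis gr : growth g time fresh x0.
Implicit Types (A B : {fset U}).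

(** In an invariant finite set, the fresh end of a latest edge labelled [l]
    would carry a second such edge, which has to be later still. *)
Lemma no_invariant_fset l B : B != fset0 ->
  [fset generator g l x | x in B]%fset != B.
Proof.
suff key k : leaves time fresh k B -> (forall x, x \in B -> generator g k x \in B) ->
    (forall x, x \in B -> generator g (inv_label k) x \in B) -> False.
  move=> B0; apply/eqP => lB.
  have lP x : x \in B -> generator g l x \in B by move=> xB; rewrite -{1}lB in_imfset.
  have lVP x : x \in B -> generator g (inv_label l) x \in B.
    by rewrite -{1}lB => /imfsetP[y yB ->]; rewrite generator_inv.
  have := leaves_edge gr l B0; rewrite lB => /orP[lv|lv].
    exact: (key l lv lP lVP).
  by apply: (key _ lv lVP) => x; rewrite inv_labelK; exact: lP.
move=> /hasP[x xB /andP[fx /allP mx]] kB kVB.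
have := fresh_first gr fx (l' := inv_label k).
have -> : inv_label k != k.
  by case: (k) => i [] /=; rewrite /inv_label /= xpair_eqE eqxx.
move=> /(_ isT); rewrite ltnNge => /negP; apply.
have := time_inv gr (inv_label k) x; rewrite inv_labelK => <-.
exact: mx (kVB x xB).
Qed.

Lemma iter_generator_inj i x : injective (fun k => iter k (g i) x).
Proof.
have no_cycle k y : iter k.+1 (g i) y <> y.
  move=> cyc; pose B := [fset iter j (g i) y | j : 'I_k.+1 in 'I_k.+1]%fset.
  have /(no_invariant_fset (i, true))/eqP : B != fset0.
    by apply/fset0Pn; exists y; apply/imfsetP; exists ord0.
  apply; apply/eqP; rewrite eqEfcard; apply/andP; split.
    apply/fsubsetP => _ /imfsetP[z /imfsetP[j _ ->] ->].
    rewrite /generator /= -iterS; apply/imfsetP => /=.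
    have [jk|] := ltnP j k; first by exists (Ordinal (jk : (j.+1 < k.+1)%N)).
    move=> kj; exists ord0 => //; have -> : nat_of_ord j = k; last exact: cyc.
    by apply/eqP; rewrite eqn_leq kj -ltnS ltn_ord.
  rewrite [X in (_ <= X)%N]card_imfset//.
  exact: (@isom_inj _ _ (generator g (i, true))).
move=> j k; wlog jk : j k / (j <= k)%N => [H e|].
  by have [jk|/ltnW kj] := leqP j k; [exact: H|apply/esym/H].
rewrite -(subnK jk) iterD; case: (k - j)%N => [|n] //= e.
by case: (no_cycle n (iter j (g i) x)); rewrite /= -e.
Qed.

Lemma iter_generator_off i A : exists k, forall a, a \in A -> iter k (g i) a \notin A.
Proof.
apply: contrapT => /forallNP noff.
have ex k : exists p : U * U,
    [/\ p.1 \in A, p.2 \in A & p.2 = iter k (g i) p.1].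
  have /existsNP[a /not_implyP[aA /negP]] := noff k.
  by rewrite negbK => kaA; exists (a, iter k (g i) a).
have [ab abP] := choice ex.
have ab_inj : injective ab.
  move=> j k abjk; have [_ _ e] := abP j; have [_ _] := abP k.
  by rewrite -abjk e; exact: iter_generator_inj.
pose AA := [seq (a, b) | a <- enum_fset A, b <- enum_fset A].
have : (size (map ab (iota 0 (size AA).+1)) <= size AA)%N.
  apply: uniq_leq_size; first by rewrite map_inj_uniq ?iota_uniq.
  move=> _ /mapP[k _ ->]; have [h1 h2 _] := abP k.
  by rewrite [ab k]surjective_pairing; apply: allpairs_f.
by rewrite size_map size_iota ltnn.
Qed.

End GrowthOrbits.

Section SpectralBound.
Context {R : realType} {Delta : set R} {U : metricType R} {H : hilbertSpace R}.
Context (hDelta : distance_set Delta) (hU : urysohn_space Delta U).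
Context (Dn0 : Delta <> [set 0]) (pi : unitaryRep (isom U) H).
Context (no_inv : forall x, Defs.invariant pi x -> x = 0).
Context {m : nat} {g : 'I_m -> isom U} {time : 'I_m * bool -> U -> nat}.
Context {fresh : 'I_m * bool -> U -> bool} {x0 : U}.
Context (gr : growth g time fresh x0).

Let nonempty_decomposition (A : {fset U}) x : fixed pi A x ->
  exists (L : seq {fset U}) (f : {fset U} -> H),
    [/\ uniq L, forall B, B \in L -> B != fset0 /\ (B `<=` A)%fset,
        forall B, pure pi B (f B) & x = \sum_(B <- L) f B].
Proof.
move=> /(pure_decomposition hDelta hU Dn0)[f [pf ->]].
exists [seq B <- fpowerset A | B != fset0], f; split=> //.
- by apply: filter_uniq; exact: fset_uniq.
- by move=> B; rewrite mem_filter fpowersetE => /andP.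
rewrite big_filter (bigD1_seq fset0) ?fset_uniq ?fpowersetE ?fsub0set//=.
by rewrite [f fset0]no_inv ?add0r//; exact: pure_fset0 (pf _).
Qed.

(** The generators permute the pure spaces along their action on finite sets,
    so only the norms of the pure parts of [x] matter, and they form a function
    on the vertices of the oriented graph. *)
Let spectral_bound_fixed A x : (0 < m)%N -> fixed pi A x ->
  \sum_(i < m) rdot (pi (g i) x) x <= Num.sqrt (2 * m%:R - 1) * nrm x ^+ 2.
Proof.
move=> m0 /nonempty_decomposition[L [f [uL LA pf ->]]].
have orth := pure_orthogonal hDelta hU Dn0.
pose G i (B : {fset U}) := [fset g i a | a in B]%fset.
have nrmE : nrm (\sum_(B <- L) f B) ^+ 2 = \sum_(B <- L) nrm (f B) ^+ 2.
  rewrite -rdotxx rdot_suml big_seq [RHS]big_seq; apply: eq_bigr => B BL.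
  rewrite rdot_sumr (bigD1_seq B)//= big1 ?addr0 ?rdotxx// => B' BB'.
  by apply: orth (pf B) (pf B') => e; rewrite e eqxx in BB'.
have coefE i : rdot (pi (g i) (\sum_(B <- L) f B)) (\sum_(B <- L) f B) <=
    \sum_(B <- L | G i B \in L) nrm (f B) * nrm (f (G i B)).
  rewrite linear_sum rdot_suml [leRHS]big_mkcond /=; apply: ler_sum => B _.
  have pg : pure pi (G i B) (pi (g i) (f B)) := pure_rep (g i) (pf B).
  rewrite rdot_sumr; case: ifP => GL.
    rewrite (bigD1_seq (G i B))//= big1 ?addr0 => [|B' BB'].
      by rewrite -(rep_nrm pi (g i) (f B)) rdot_le.
    by apply: orth pg (pf B') => e; rewrite e eqxx in BB'.
  rewrite big_seq big1// => B' B'L; apply: orth pg (pf B') => e.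
  by rewrite e B'L in GL.
rewrite nrmE; apply: le_trans (ler_sum _ (fun i _ => coefE i)) _.
apply: (kesten_bound (g := G) (out := leaves time fresh)) => //.
- move=> i; apply: can_inj (fun B : {fset U} => [fset (g i)^-1%g a | a in B]%fset) _ => B.
  rewrite -imfset_comp -[RHS](imfset_id); apply: eq_in_imfset => // a _ /=.
  exact: isom_funK.
- move=> B _; apply: leq_trans (_ : (#|[pred l | leaves time fresh l B]| <= 1)%N).
    rewrite -sum1_card [X in (_ <= X)%N]big_mkcond /=.
    by apply: leq_sum => l _; rewrite inE; case: leaves.
  by apply/card_le1_eqP => l l'; rewrite !inE => h h'; exact: (leaves_uniq gr h' h).
- by move=> i B /LA[B0 _]; exact: (leaves_edge gr (i, true) B0).
Qed.

(** Kesten's norm of the random walk on the free group bounds the average of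
    the generators in every representation without invariant vectors. *)
Lemma spectral_bound x : (0 < m)%N ->
  \sum_(i < m) rdot (pi (g i) x) x <= Num.sqrt (2 * m%:R - 1) * nrm x ^+ 2.
Proof.
move=> m0; set c := Num.sqrt _; have c0 : 0 <= c by exact: sqrtr_ge0.
have nx := nrm_ge0 x.
pose K := (c + m%:R) * (2 * nrm x + 1).
have mR : 0 < m%:R :> R by rewrite ltr0n.
have K0 : 0 < K by rewrite mulr_gt0//; lra.
apply/ler_addgt0Pr => d d0.
pose e := Num.min 1 (d / K).
have e0 : 0 < e by rewrite lt_min ltr01 divr_gt0.
have e1 : e <= 1 by rewrite ge_min lexx.
have eK : e * K <= d by rewrite -ler_pdivlMr// ge_min lexx orbT.
have [A [y [fy yx]]] := fixed_dense pi x e0.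
have ny : nrm y <= nrm x + e.
  by rewrite -[y](subrK x) addrC (le_trans (ler_nrmD _ _))// lerD2l.
have near i : rdot (pi (g i) x) x <= rdot (pi (g i) y) y + (2 * nrm x + 1) * e.
  have -> : rdot (pi (g i) x) x = rdot (pi (g i) y) y
      + (rdot (pi (g i) (x - y)) x + rdot (pi (g i) y) (x - y)).
    by rewrite linearB rdotBl rdotBr; ring.
  have := rdot_le (pi (g i) (x - y)) x; have := rdot_le (pi (g i) y) (x - y).
  rewrite !rep_nrm (nrm_distC x y) lerD2l.
  have := nrm_ge0 (y - x); have := nrm_ge0 y.
  by nra.
have := ler_sum (index_enum 'I_m) (fun i (_ : true) => near i).
rewrite big_split /= sumr_const card_ord -mulr_natl.
have := spectral_bound_fixed m0 fy; rewrite -/c.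
have : nrm y ^+ 2 <= nrm x ^+ 2 + (2 * nrm x + 1) * e.
  by have := nrm_ge0 y; nra.
move=> /(ler_wpM2l c0); move: eK; rewrite /K.
by lra.
Qed.

(** A high power [h] of the generator moves the finite set supporting an
    approximation [y] of [x] off itself; then [pi h y] is orthogonal to [y],
    although both are close to [x]. *)
Lemma generator_no_invariant i x : pi (g i) x = x -> x = 0.
Proof.
move=> gx; apply: nrm_eq0; apply/eqP; rewrite eq_le nrm_ge0 andbT.
apply/ler_addgt0Pr => e e0; rewrite add0r.
have e30 : 0 < e / 3 by rewrite divr_gt0.
have [A [y [fy yx]]] := fixed_dense pi x e30.
have [k kA] := iter_generator_off gr i A.
have [h [hE hx]] : exists h : isom U, (forall a, h a = iter k (g i) a) /\ pi h x = x.
  elim: (k) => [|j [h [hE hx]]]; first by exists 1%g; rewrite rep1.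
  by exists (g i * h)%g; split=> [a|]; [rewrite /= hE|rewrite repM hx].
have hy : rdot (pi h y) y = 0.
  have [L [f [uL LA pf ->]]] := nonempty_decomposition fy.
  rewrite linear_sum rdot_suml big_seq big1// => B BL.
  rewrite rdot_sumr big_seq big1// => B' B'L.
  apply: (pure_orthogonal hDelta hU Dn0) (pure_rep h (pf B)) (pf B') => e'.
  have [/fset0Pn[b bB] BA] := LA B BL; have [_ B'A] := LA B' B'L.
  have : h b \in A by apply: (fsubsetP B'A); rewrite -e' in_imfset.
  by rewrite hE; apply/negP/kA/(fsubsetP BA).
have : nrm (pi h y - y) <= e / 3 + e / 3.
  apply: (le_trans (ler_nrm_dist x _ _)).
  by rewrite -{1}hx -linearB rep_nrm (nrm_distC x y) lerD.
have : nrm (pi h y - y) ^+ 2 = 2 * nrm y ^+ 2.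
  by rewrite sqr_nrmB rep_nrm hy; ring.
have : nrm x <= nrm y + e / 3.
  by rewrite -[x](subrK y) addrC (le_trans (ler_nrmD _ _))// lerD2l nrm_distC.
have := nrm_ge0 (pi h y - y); have := nrm_ge0 y.
by nra.
Qed.

End SpectralBound.

(** * Isometries in general position *)

Section GenericIsometries.
Context {R : realType} {Delta : set R} {U : metricType R}.
Context (hDelta : distance_set Delta) (hU : urysohn_space Delta U).
Context (Dn0 : Delta <> [set 0]) (m : nat) (x0 : U).

(** A label [i], a source [x] and a target [y] with [g i x = y], and whether
    the fresh end is the source. *)
Let edge := ('I_m * (U * U) * bool)%type.
Implicit Types (e : edge) (s : seq edge).

Let idx e : 'I_m := e.1.1.
Let src e : U := e.1.2.1.
Let dst e : U := e.1.2.2.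
Let fresh_end e : U := if e.2 then src e else dst e.
Let old_end e : U := if e.2 then dst e else src e.

Let vertices s : seq U := map src s ++ map dst s.

Let compatible e e' : Prop :=
  idx e = idx e' -> mdist (src e) (src e') = mdist (dst e) (dst e').

(* The most recent edge comes first. *)
Fixpoint grown s : Prop :=
  if s is e :: s' then
    [/\ grown s', fresh_end e \notin vertices s', fresh_end e != old_end e,
        fresh_end e != x0 & forall e', e' \in s' -> compatible e e']
  else True.

Let grown_compatible s e e' : grown s -> e \in s -> e' \in s -> compatible e e'.
Proof.
elim: s => //= a s IHs [gs _ _ _ ca]; rewrite !inE => /orP[/eqP->|es] /orP[/eqP->|es'].
- by move=> _; rewrite !mdistxx.
- exact: ca.
- by move=> /esym/(ca _ es); rewrite metric_sym (metric_sym (dst a)).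
- exact: IHs.
Qed.

Let mem_vertices s e : e \in s -> (src e \in vertices s) * (dst e \in vertices s).
Proof. by move=> es; rewrite !mem_cat (map_f src es) (map_f dst es) orbT. Qed.

(** Extend the partial isometry [P] to the whole space, then move the image of
    [u] off [B] by an isometry fixing the range of [P]. *)
Lemma generic_extension (P : seq (U * U)) (B : {fset U}) u :
  (forall p q, p \in P -> q \in P -> mdist p.1 q.1 = mdist p.2 q.2) ->
  u \notin map fst P ->
  exists2 v, v \notin B & forall p, p \in P -> mdist u p.1 = mdist v p.2.
Proof.
move=> iso uP; have [_ _ hom _] := hU.
have fex x : exists y, forall p, p \in P -> p.1 = x -> y = p.2.
  have [[p [pP px]]|np] := pselect (exists p, p \in P /\ p.1 = x).
    exists p.2 => q qP qx; apply: mdist_positivity.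
    by rewrite -iso// px qx mdistxx.
  by exists x => p pP px; case: np; exists p.
have [f fP] := choice fex.
have [||h hP] := @hom [set` [fset x | x in map fst P]%fset] f.
- exact: finite_fset.
- move=> x y; rewrite /= !inE /= => /mapP[p pP ->] /mapP[q qP ->].
  by rewrite (fP _ p)// (fP _ q)// iso.
have hE p : p \in P -> h p.1 = p.2.
  by move=> pP; rewrite hP; [exact: fP|rewrite /= !inE /=; exact: map_f].
have [|g gF gB] := @move_point_off _ _ _ hDelta hU Dn0 [fset x | x in map snd P]%fset
    B (h u).
  rewrite inE /=; apply: contra uP => /mapP[p pP]; rewrite -hE// => /isom_inj->.
  exact: map_f.
exists (g (h u)) => // p pP.
rewrite -{1}(isom_mdist h) hE// -[in RHS](gF p.2) ?isom_mdist//.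
  by rewrite inE /=; exact: map_f.
Qed.

Let served (i : 'I_m) (u : U) (b : bool) s : Prop :=
  exists e, [/\ e \in s, idx e = i & (if b then src e else dst e) = u].

(** A missing edge at [u] is drawn to a point outside everything used so far,
    which thereby becomes its fresh end. *)
Let grow_step i u b s : grown s ->
  exists s', [/\ grown s', s' = s \/ (exists e, s' = e :: s) & served i u b s'].
Proof.
move=> gs; have [su|nsu] := pselect (served i u b s).
  by exists s; split=> //; left.
pose si := [seq e <- s | idx e == i].
pose P := [seq (if b then e.1.2 else (e.1.2.2, e.1.2.1)) | e <- si].
have siP e : e \in si -> e \in s /\ idx e = i.
  by rewrite mem_filter => /andP[/eqP].
have [||v vB vP] := @generic_extension P (u |` (x0 |` [fset x | x in vertices s]))%fset u.
- move=> _ _ /mapP[e /siP[es ei] ->] /mapP[e' /siP[es' ei'] ->].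
  have := grown_compatible gs es es'; rewrite /compatible ei ei' => /(_ erefl).
  by rewrite /src /dst; case: (b).
- apply/negP => /mapP[_ /mapP[e /siP[es ei] ->] ue]; apply: nsu.
  by exists e; split=> //; rewrite ue; case: (b).
move: vB; rewrite !in_fset1U !negb_or !inE /= => /and3P[vu vx0 vs'].
have vs : v \notin vertices s by rewrite mem_cat.
exists ((i, if b then (u, v) else (v, u), ~~ b) :: s); split; last 2 first.
- by right; eexists.
- exists (i, if b then (u, v) else (v, u), ~~ b); split=> //; first exact: mem_head.
  by rewrite /src /dst /=; case: (b).
have fe : fresh_end (i, if b then (u, v) else (v, u), ~~ b) = v.
  by rewrite /fresh_end /src /dst /=; case: (b).
have oe : old_end (i, if b then (u, v) else (v, u), ~~ b) = u.
  by rewrite /old_end /src /dst /=; case: (b).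
split; rewrite ?fe ?oe// => e es ie.
have := vP (if b then e.1.2 else (e.1.2.2, e.1.2.1)).
have -> : (if b then e.1.2 else (e.1.2.2, e.1.2.1)) \in P.
  by apply: (map_f (fun e : edge => if b then e.1.2 else _)); rewrite mem_filter es -ie eqxx.
by move=> /(_ isT); rewrite /src /dst /=; case: (b).
Qed.

(** Every label is served at every point in both directions, so the limits of
    the partial isometries are defined everywhere and surjective. The fresh end
    of an edge met no earlier edge: this is [fresh_first]. *)
Lemma growth_exists : (0 < m)%N ->
  exists (g : 'I_m -> isom U) time fresh, growth g time fresh x0.
Proof.
move=> m0; have [cU _ _ _] := hU.
have [enumU enumUP] : exists f : nat -> U, forall u, exists k, f k = u.
  have /countable_injP[code code_inj] := cU.
  have dec k : exists u, (exists u', code u' = k) -> code u = k.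
    have [[u uk]|nu] := pselect (exists u', code u' = k); first by exists u.
    by exists x0.
  have [f fP] := choice dec; exists f => u; exists (code u).
  by apply: code_inj; rewrite ?in_setT//; apply: fP; exists u.
pose task := ('I_m * nat * bool)%type.
have stepex (ns : nat * seq edge) : exists s', grown ns.2 ->
    [/\ grown s', s' = ns.2 \/ (exists e, s' = e :: ns.2) &
      forall t : task, choice.unpickle ns.1 = Some t -> served t.1.1 (enumU t.1.2) t.2 s'].
  have [gs|ngs] := pselect (grown ns.2); last by exists [::].
  case nt : (choice.unpickle ns.1 : option task) => [[[i k] b]|]; last first.
    by exists ns.2; split=> //; left.
  have [s' [gs' ext srv]] := grow_step i (enumU k) b gs.
  by exists s'; split=> // t [<-].
have [F FP] := choice stepex.
pose S := fix S n := if n is n'.+1 then F (n', S n') else [::].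
have SP n : grown (S n) by elim: n => //= n IHn; have [] := FP (n, S n) IHn.
have Sstep n : S n.+1 = S n \/ exists e, S n.+1 = e :: S n.
  by have [] := FP (n, S n) (SP n).
have Smono n k e : (n <= k)%N -> e \in S n -> e \in S k.
  move=> /subnK <-; elim: (k - n)%N => [//|j IHj] en; have := IHj en.
  rewrite addSn; case: (Sstep (j + n)%N) => [->//|[a ->]].
  by rewrite inE => ->; rewrite orbT.
have Sserved i u b : exists n, served i u b (S n).
  have [k <-] := enumUP u; pose t : task := (i, k, b).
  exists (choice.pickle t).+1; have [_ _ srv] := FP (choice.pickle t, S (choice.pickle t)) (SP _).
  by have := srv t; rewrite choice.pickleK; exact.
have Sbirth n e : e \in S n -> exists k, S k.+1 = e :: S k.
  elim: n => // n IHn; case: (Sstep n) => [->//|[a aE]].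
  by rewrite aE inE => /orP[/eqP->|/IHn//]; exists n.
have Scomp n k e e' : e \in S n -> e' \in S k -> compatible e e'.
  move=> en ek; apply: (@grown_compatible (S (maxn n k))) => //.
    by apply: Smono en; exact: leq_maxl.
  by apply: Smono ek; exact: leq_maxr.
have gex i : exists g : isom U, forall n e, e \in S n -> idx e = i -> g (src e) = dst e.
  have fex x : exists y, forall n e, e \in S n -> idx e = i -> src e = x -> y = dst e.
    have [n [e [en ei ex]]] := Sserved i x true; exists (dst e) => k e' ek ei' ex'.
    by apply: mdist_positivity; rewrite -(Scomp n k)// ?ei// ex ex' mdistxx.
  have [f fP] := choice fex.
  have fiso x y : mdist (f x) (f y) = mdist x y.
    have [n [e [en ei ex]]] := Sserved i x true; have [k [e' [ek ei' ey]]] := Sserved i y true.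
    by rewrite (fP x n e)// (fP y k e')// -(Scomp n k)// ?ei// ex ey.
  have fsurj y : exists x, f x = y.
    have [n [e [en ei ey]]] := Sserved i y false; exists (src e).
    by rewrite (fP _ n e).
  by exists (Isom fiso fsurj) => n e en ei; apply/(fP _ n).
have [g gP] := choice gex.
have birth (p : 'I_m * U) : exists q : nat * bool,
    S q.1.+1 = (p.1, (p.2, g p.1 p.2), q.2) :: S q.1.
  case: p => i x; have [n [e [en ei ex]]] := Sserved i x true.
  have [k kE] := Sbirth n e en; exists (k, e.2); rewrite kE /=; congr (_ :: _).
  have ge := gP i n e en ei; move: ge ei ex; rewrite /idx /src /dst.
  by case: (e) => [[j [y z]] b] /= ge -> <-; rewrite ge.
have [T TP] := choice birth.
pose start (l : 'I_m * bool) x := if l.2 then x else (g l.1)^-1%g x.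
pose time l x := (T (l.1, start l x)).1.
pose fresh l x := let b := (T (l.1, start l x)).2 in if l.2 then b else ~~ b.
pose the_edge l x : edge := (l.1, (start l x, g l.1 (start l x)), (T (l.1, start l x)).2).
have bornE l x : S (time l x).+1 = the_edge l x :: S (time l x) by exact: TP.
have gE l x : fresh l x -> fresh_end (the_edge l x) = x.
  rewrite /fresh /fresh_end /the_edge /src /dst /start /=; case: l => i [] /= => [->//|].
  by move=> /negbTE->; exact: isom_inv_funK.
have onE l x : x \in [:: src (the_edge l x); dst (the_edge l x)].
  rewrite !inE /the_edge /src /dst /start /=; case: l => i [] /=; rewrite ?eqxx//.
  by rewrite isom_inv_funK eqxx orbT.
have bornP l x : [/\ fresh_end (the_edge l x) \notin vertices (S (time l x)),
    src (the_edge l x) != dst (the_edge l x) & fresh_end (the_edge l x) != x0].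
  have := SP (time l x).+1; rewrite bornE /= => -[_ h1 h2 h3 _]; split=> //.
  by move: h2; rewrite /fresh_end /old_end; case: ifP => //; rewrite eq_sym.
exists g, time, fresh; split.
- move=> [i b] x; rewrite /time /start /inv_label /generator /=.
  by case: b => //=; rewrite isom_funK.
- move=> [i b] x; rewrite /fresh /start /inv_label /generator /=.
  by case: b => //=; rewrite ?isom_funK ?negbK.
- move=> l l' x fl l'l; rewrite ltnNge; apply/negP; rewrite leq_eqVlt => /orP[/eqP tt|tt].
    have := bornE l' x; rewrite tt bornE => -[il sl _]; case/eqP: l'l.
    have [_ + _] := bornP l x; rewrite /the_edge /src /dst /=.
    move: il sl; rewrite /start; case: (l) => i [] /=; case: (l') => j [] /= -> //.
      by move=> sl /eqP[]; rewrite [in RHS]sl isom_inv_funK.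
    by move=> sl /eqP[]; rewrite isom_inv_funK.
  have [+ _ _] := bornP l x; rewrite gE// => /negP; apply.
  have : the_edge l' x \in S (time l x).
    by apply: (Smono _ _ _ tt); rewrite bornE mem_head.
  move=> /mem_vertices[h1 h2]; have := onE l' x; rewrite !inE.
  by move=> /orP[] /eqP xE; rewrite [X in X \in _]xE.
- move=> l; apply/negP => fl; have [_ _] := bornP l x0.
  by rewrite gE// eqxx.
Qed.

End GenericIsometries.

(** * The Hilbert space of square-summable families *)

Section Sums.
Context {R : realType} {T : choiceType}.
Implicit Types (h k : T -> R) (J : {fset T}).

Local Notation totally := summability.totally.
#[local] Existing Instance summability.totally_filter.

Definition absolutely_summable h : Prop :=
  exists M, forall J, \sum_(x <- J) `|h x| <= M.

Definition fsum h J : R := \sum_(x <- J) h x.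

(** The unconditional sum, a limit along the directed set of finite subsets. *)
Definition rsum h : R := lim (fsum h @ @totally T).

Lemma absolutely_summable_le h k : absolutely_summable k ->
  (forall x, `|h x| <= `|k x|) -> absolutely_summable h.
Proof.
by move=> [M kM] hk; exists M => J; apply: le_trans (kM J); exact: ler_sum.
Qed.

Lemma absolutely_summableD h k : absolutely_summable h ->
  absolutely_summable k -> absolutely_summable (fun x => h x + k x).
Proof.
move=> [M hM] [N kN]; exists (M + N) => J; apply: (@le_trans _ _ _ _ _ _ (lerD (hM J) (kN J))).
by rewrite -big_split; apply: ler_sum => x _; exact: ler_normD.
Qed.

Lemma absolutely_summableZ a h : absolutely_summable h ->
  absolutely_summable (fun x => a * h x).
Proof.
move=> [M hM]; exists (`|a| * M) => J.
by under eq_bigr do rewrite normrM; rewrite -mulr_sumr ler_wpM2l.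
Qed.

Lemma ler_sum_fset h J J' : (forall x, 0 <= h x) -> (J `<=` J')%fset ->
  \sum_(x <- J) h x <= \sum_(x <- J') h x.
Proof.
move=> h0 JJ'; rewrite [leRHS](big_fsetID _ (mem J))/=.
have -> : [fset x in J' | x \in J]%fset = J.
  apply/fsetP => x; rewrite !inE /= andbC.
  by case: (boolP (x \in J)) => //= /(fsubsetP JJ').
by rewrite lerDl sumr_ge0.
Qed.

Let cvg_nonneg h : (forall x, 0 <= h x) -> absolutely_summable h ->
  fsum h @ @totally T -->
    sup [set \sum_(x <- J) h x | J in [set: {fset T}]].
Proof.
move=> h0 [M hM]; set S := [set _ | _ in _].
have hE J : \sum_(x <- J) `|h x| = \sum_(x <- J) h x.
  by apply: eq_bigr => x _; rewrite ger0_norm.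
have supS : has_sup S.
  split; first by exists (\sum_(x <- fset0) h x), fset0.
  by exists M => _ [J _ <-]; rewrite -hE.
apply/cvgrPdist_lt => e e0; have [_ [J _ <-] Je] := sup_adherent e0 supS.
exists J => // J' /= JJ'.
have le1 : \sum_(x <- J') h x <= sup S by apply: sup_upper_bound => //; exists J'.
rewrite ger0_norm ?subr_ge0// ltrBlDr -ltrBlDl.
by rewrite (lt_le_trans Je)// ler_sum_fset.
Qed.

Lemma rsum_cvg h : absolutely_summable h ->
  fsum h @ @totally T --> rsum h.
Proof.
move=> sh; apply/cvg_ex.
pose hp x : R := `|h x|; pose hn x : R := `|h x| - h x.
have shp : absolutely_summable hp.
  by apply: absolutely_summable_le (sh) _ => x; rewrite /hp normr_id.
have shn : absolutely_summable hn.
  apply: absolutely_summable_le (absolutely_summableZ 2 sh) _ => x.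
  rewrite /hn normrM (le_trans (ler_normB _ _))// normr_id.
  by rewrite [X in _ <= X * _]ger0_norm// mulr_natl.
have hp0 x : 0 <= hp x by exact: normr_ge0.
have hn0 x : 0 <= hn x by rewrite subr_ge0 ler_norm.
have hE : fsum h = fsum hp \- fsum hn.
  apply/funext => J; rewrite /fsum /= -[RHS]sumrB; apply: eq_bigr => x _.
  by rewrite /hp /hn subKr.
by eexists; rewrite hE; exact: cvgB (cvg_nonneg hp0 shp) (cvg_nonneg hn0 shn).
Qed.

Lemma rsum_unique h l : fsum h @ @totally T --> l -> rsum h = l.
Proof. by move=> /cvg_lim; apply. Qed.

Lemma eq_rsum h k : h =1 k -> rsum h = rsum k.
Proof. by move=> /funext ->. Qed.

Lemma rsumD h k : absolutely_summable h -> absolutely_summable k ->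
  rsum (fun x => h x + k x) = rsum h + rsum k.
Proof.
move=> /rsum_cvg ch /rsum_cvg ck; apply: rsum_unique.
have -> : fsum (fun x => h x + k x) = fsum h \+ fsum k.
  by apply/funext => J; rewrite /fsum big_split.
exact: cvgD.
Qed.

Lemma rsumZ a h : absolutely_summable h -> rsum (fun x => a * h x) = a * rsum h.
Proof.
move=> /rsum_cvg ch; apply: rsum_unique.
have -> : fsum (fun x => a * h x) = (fun J => a * fsum h J).
  by apply/funext => J; rewrite /fsum mulr_sumr.
exact: cvgMr.
Qed.

Lemma rsum_ge h J : (forall x, 0 <= h x) -> absolutely_summable h ->
  \sum_(x <- J) h x <= rsum h.
Proof.
move=> h0 sh; apply: (cvgr_to_ge (rsum_cvg sh)).
by exists J => // J' /= JJ'; exact: ler_sum_fset.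
Qed.

Lemma rsum_le h M : absolutely_summable h ->
  (forall J, \sum_(x <- J) h x <= M) -> rsum h <= M.
Proof. by move=> sh hM; apply: (cvgr_to_le (rsum_cvg sh)); exact: nearW. Qed.

Lemma rsum0 h : (forall x, h x = 0) -> rsum h = 0.
Proof.
move=> h0; apply: rsum_unique.
have -> : fsum h = cst 0 by apply/funext => J; rewrite /fsum big1.
exact: cvg_cst.
Qed.

Lemma rsum_reindex h (s t : T -> T) : cancel s t -> cancel t s ->
  absolutely_summable h -> rsum (fun x => h (s x)) = rsum h.
Proof.
move=> st ts sh; apply: rsum_unique.
have -> : fsum (fun x => h (s x)) = fsum h \o (fun J => [fset s x | x in J]%fset).
  apply/funext => J; rewrite /fsum /= big_imfset//= => x y _ _.
  exact: can_inj st _ _.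
apply: cvg_comp (rsum_cvg sh) => P [J _ JP].
exists [fset t x | x in J]%fset => // J' /= JJ'; apply: JP => /=.
apply/fsubsetP => x xJ; rewrite -(ts x) in_imfset//=.
by apply: (fsubsetP JJ'); rewrite in_imfset.
Qed.

Lemma absolutely_summable_reindex h (s t : T -> T) : cancel s t ->
  absolutely_summable h -> absolutely_summable (fun x => h (s x)).
Proof.
move=> st [M hM]; exists M => J; apply: le_trans (hM [fset s x | x in J]%fset).
by rewrite big_imfset//= => x y _ _; exact: can_inj st _ _.
Qed.

End Sums.

Section SquareSummable.
Context {R : realType} {T : choiceType}.
Local Notation C := R[i].
Implicit Types (z w : C).

Definition sqmod z : R := complex.Re z ^+ 2 + complex.Im z ^+ 2.

Lemma sqmod_ge0 z : 0 <= sqmod z.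
Proof. by rewrite addr_ge0 ?sqr_ge0. Qed.

Lemma sqmod_eq0 z : sqmod z = 0 -> z = 0.
Proof.
case: z => a b; rewrite /sqmod /= => /eqP; rewrite paddr_eq0 ?sqr_ge0// !sqrf_eq0.
by move=> /andP[/eqP-> /eqP->].
Qed.

Lemma sqmodM z w : sqmod (z * w) = sqmod z * sqmod w.
Proof. by case: z => a b; case: w => c d; rewrite /sqmod /=; ring. Qed.

Lemma sqmodD z w : sqmod (z + w) <= 2 * (sqmod z + sqmod w).
Proof.
case: z => a b; case: w => c d; rewrite /sqmod /=.
have := sqr_ge0 (a - c); have := sqr_ge0 (b - d).
by rewrite !expr2; lra.
Qed.

Definition l2_pred : {pred T -> C^o} :=
  fun f => `[< absolutely_summable (fun x => sqmod (f x)) >].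

Lemma l2_submod : submod_closed l2_pred.
Proof.
split=> [|a f g /asboolP sf /asboolP sg].
  apply/asboolP; exists 0 => J; rewrite big1// => x _.
  by rewrite /sqmod /= expr0n addr0 normr0.
apply/asboolP; apply: (@absolutely_summable_le _ _ _
    (fun x => 2 * (sqmod a * sqmod (f x) + sqmod (g x)))).
  by apply/absolutely_summableZ/absolutely_summableD; first exact: absolutely_summableZ.
move=> x; rewrite ger0_norm ?sqmod_ge0// (le_trans _ (ler_norm _))//.
by rewrite (le_trans (sqmodD _ _))// sqmodM.
Qed.

HB.instance Definition _ := GRing.isSubmodClosed.Build C (T -> C^o) l2_pred l2_submod.

Record l2 := L2 { l2_fun :> T -> C^o ; l2_funP : l2_fun \in l2_pred }.

HB.instance Definition _ := [isSub for l2_fun].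
HB.instance Definition _ := [Choice of l2 by <:].
HB.instance Definition _ := [SubChoice_isSubLmodule of l2 by <:].

End SquareSummable.
Arguments l2 R T : clear implicits.

Section L2InnerProduct.
Context {R : realType} {T : choiceType}.
Local Notation C := R[i].
Local Notation Re := complex.Re.
Local Notation Im := complex.Im.
Implicit Types (f g : l2 R T) (a : C) (x : T) (J : {fset T}).

Lemma l2P f g : (forall x, f x = g x) -> f = g.
Proof. by move=> fg; apply: val_inj; apply/funext. Qed.

Lemma l2D f g x : (f + g) x = f x + g x. Proof. by []. Qed.
Lemma l2N f x : (- f) x = - f x. Proof. by []. Qed.
Lemma l2Z a f x : (a *: f) x = a * f x. Proof. by []. Qed.
Lemma l2_0 x : (0 : l2 R T) x = 0. Proof. by []. Qed.

Lemma summable_sqmod f : absolutely_summable (fun x => sqmod (f x)).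
Proof. by have /asboolP := l2_funP f. Qed.

Let re f g x : R := Re (f x) * Re (g x) + Im (f x) * Im (g x).
Let im f g x : R := Im (f x) * Re (g x) - Re (f x) * Im (g x).

Let bound (a b c d : R) : (`|a * c + b * d| <= (a ^+ 2 + b ^+ 2) + (c ^+ 2 + d ^+ 2)).
Proof.
have := sqr_ge0 (a - c); have := sqr_ge0 (b - d).
have := sqr_ge0 (a + c); have := sqr_ge0 (b + d).
have := sqr_ge0 a; have := sqr_ge0 b; have := sqr_ge0 c; have := sqr_ge0 d.
by rewrite !expr2 ler_norml => *; apply/andP; split; lra.
Qed.

Let summable_bound f g (h : T -> R) :
  (forall x, `|h x| <= sqmod (f x) + sqmod (g x)) -> absolutely_summable h.
Proof.
move=> hb; apply: absolutely_summable_le (absolutely_summableD (summable_sqmod f)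
  (summable_sqmod g)) _ => x.
by apply: (le_trans (hb x)); rewrite ler_norm.
Qed.

Let summable_re f g : absolutely_summable (re f g).
Proof. by apply: (@summable_bound f g) => x; exact: bound. Qed.

Let summable_im f g : absolutely_summable (im f g).
Proof.
apply: (@summable_bound f g) => x; rewrite /im -mulrN addrC.
apply: (le_trans (bound _ _ _ _)).
by rewrite sqrrN /sqmod (addrC (Im (g x) ^+ 2)).
Qed.

Definition l2_inner f g : C := Complex (rsum (re f g)) (rsum (im f g)).

Lemma l2_inner_reindex (s t : T -> T) f g f' g' : cancel s t -> cancel t s ->
  (forall x, f' x = f (s x)) -> (forall x, g' x = g (s x)) ->
  l2_inner f' g' = l2_inner f g.
Proof.
move=> st ts ff' gg'; apply/eqP; rewrite eq_complex; apply/andP; split; apply/eqP.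
  rewrite /= -(rsum_reindex st ts (summable_re f g)).
  by apply: eq_rsum => x; rewrite /re ff' gg'.
rewrite /= -(rsum_reindex st ts (summable_im f g)).
by apply: eq_rsum => x; rewrite /im ff' gg'.
Qed.

Lemma l2_inner_disjoint f g : (forall x, f x = 0 \/ g x = 0) -> l2_inner f g = 0.
Proof.
move=> fg; apply/eqP; rewrite eq_complex; apply/andP; split; apply/eqP.
  by apply: rsum0 => x; rewrite /re; case: (fg x) => ->; rewrite /= !(mul0r, mulr0) addr0.
by apply: rsum0 => x; rewrite /im; case: (fg x) => ->; rewrite /= !(mul0r, mulr0) subr0.
Qed.

Let rsum_combination (r s : R) (h k : T -> R) : absolutely_summable h ->
  absolutely_summable k ->
  rsum (fun x => r * h x + s * k x) = r * rsum h + s * rsum k.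
Proof.
by move=> sh sk; rewrite rsumD ?rsumZ//; exact: absolutely_summableZ.
Qed.

Let innerBl g : zmod_morphism (l2_inner ^~ g).
Proof.
move=> f f' /=; apply/eqP; rewrite eq_complex /=; apply/andP; split; apply/eqP.
  rewrite -[- rsum _]mulN1r -[rsum (re f g)]mul1r -rsum_combination//.
  by apply: eq_rsum => x; rewrite /re l2D l2N !raddfB /=; ring.
rewrite -[- rsum _]mulN1r -[rsum (im f g)]mul1r -rsum_combination//.
by apply: eq_rsum => x; rewrite /im l2D l2N !raddfB /=; ring.
Qed.

Let innerZl g : scalable_for *%R (l2_inner ^~ g).
Proof.
move=> a f /=; apply/eqP; rewrite eq_complex; case: a => a b /=.
apply/andP; split; apply/eqP.
  rewrite -mulNr -rsum_combination//; apply: eq_rsum => x.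
  by rewrite /re /im l2Z; case: (f x) => u v /=; ring.
rewrite -rsum_combination//; apply: eq_rsum => x.
by rewrite /re /im l2Z; case: (f x) => u v /=; ring.
Qed.

Let innerC f g : l2_inner f g = (-1) ^+ false * Num.conj (l2_inner g f).
Proof.
rewrite expr0 mul1r; apply/eqP; rewrite eq_complex; apply/andP; split; apply/eqP.
  by apply: eq_rsum => x; rewrite /re; ring.
rewrite /= -mulN1r -rsumZ//; apply: eq_rsum => x.
by rewrite /im; ring.
Qed.

Let innerCE f g : l2_inner f g = Num.conj (l2_inner g f).
Proof. by rewrite innerC expr0 mul1r. Qed.

Let innerBr f : zmod_morphism (l2_inner f).
Proof.
move=> g g'; rewrite innerCE (innerBl f g g') (innerCE f g) (innerCE f g').
exact: rmorphB.
Qed.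

Let innerZr f : scalable_for (Num.conj \; *%R) (l2_inner f).
Proof.
move=> a g; rewrite innerCE (innerZl f a g) (innerCE f g) /=.
exact: rmorphM.
Qed.

HB.instance Definition _ := isBilinear.Build C (l2 R T) (l2 R T) C *%R
  (Num.conj \; *%R) l2_inner innerBl innerBr innerZl innerZr.

HB.instance Definition _ :=
  isHermitianSesquilinear.Build C (l2 R T) false Num.conj l2_inner innerC.

Definition l2_sqnorm f : R := rsum (fun x => sqmod (f x)).

Lemma l2_inner_sqnorm f : l2_inner f f = (l2_sqnorm f)%:C%C.
Proof.
apply/eqP; rewrite eq_complex /=; apply/andP; split; apply/eqP.
  by apply: eq_rsum => x; rewrite /re /sqmod !expr2.
by apply: rsum0 => x; rewrite /im; ring.
Qed.

Lemma l2_sqnorm_ge f J : \sum_(x <- J) sqmod (f x) <= l2_sqnorm f.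
Proof. by apply: rsum_ge => [x|]; [exact: sqmod_ge0|exact: summable_sqmod]. Qed.

Lemma l2_sqnorm_le f M : (forall J : {fset T}, \sum_(x <- J) sqmod (f x) <= M) ->
  l2_sqnorm f <= M.
Proof. by apply: rsum_le; exact: summable_sqmod. Qed.

Lemma l2_sqnorm_ge0 f : 0 <= l2_sqnorm f.
Proof. by have := l2_sqnorm_ge f fset0; rewrite big_seq_fset0. Qed.

Lemma sqmod_le_l2 f x : sqmod (f x) <= l2_sqnorm f.
Proof. by have := l2_sqnorm_ge f [fset x]%fset; rewrite big_seq_fset1. Qed.

Lemma l2_sqnorm_eq0 f : l2_sqnorm f = 0 -> f = 0.
Proof.
move=> f0; apply: l2P => x; apply: sqmod_eq0; apply/eqP.
by rewrite eq_le sqmod_ge0 andbT -f0 sqmod_le_l2.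
Qed.

Let dot_gt0 f : f != 0 -> 0 < l2_inner f f.
Proof.
move=> f0; rewrite l2_inner_sqnorm ltcR lt_neqAle l2_sqnorm_ge0 andbT.
by rewrite eq_sym; apply: contra f0 => /eqP/l2_sqnorm_eq0 ->.
Qed.

HB.instance Definition _ := isDotProduct.Build C (l2 R T) l2_inner dot_gt0.

Let sqnormZ a f : l2_sqnorm (a *: f) = sqmod a * l2_sqnorm f.
Proof.
rewrite /l2_sqnorm -rsumZ; last exact: summable_sqmod.
by apply: eq_rsum => x; rewrite l2Z sqmodM.
Qed.

Let sqnormD f g : l2_sqnorm (f + g) =
  l2_sqnorm f + l2_sqnorm g + 2 * Re (l2_inner f g).
Proof.
have sf := summable_sqmod f; have sg := summable_sqmod g.
rewrite /l2_sqnorm -rsumD// -[rsum _ in RHS]mul1r -rsum_combination//; last first.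
  exact: absolutely_summableD.
by apply: eq_rsum => x; rewrite /re /sqmod !raddfD /=; ring.
Qed.

Let norm f : R := Num.sqrt (l2_sqnorm f).

Let norm_sqr f : norm f ^+ 2 = l2_sqnorm f.
Proof. by rewrite sqr_sqrtr// l2_sqnorm_ge0. Qed.

Let Re_innerZ (r s : R) f g :
  Re (l2_inner (r%:C%C *: f) (s%:C%C *: g)) = r * s * Re (l2_inner f g).
Proof.
rewrite /= -rsumZ//; apply: eq_rsum => x; rewrite /re !l2Z.
by case: (f x) => ? ?; case: (g x) => ? ? /=; ring.
Qed.

Let inner_le f g : Re (l2_inner f g) <= norm f * norm g.
Proof.
have norm0 h : norm h = 0 -> h = 0.
  by move=> h0; apply: l2_sqnorm_eq0; rewrite -norm_sqr h0 expr0n.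
have ng0 h h' : h = 0 \/ h' = 0 -> Re (l2_inner h h') <= norm h * norm h'.
  move=> hh'; apply: le_trans (_ : 0 <= _); last by rewrite mulr_ge0 ?sqrtr_ge0.
  rewrite le_eqVlt; apply/orP; left; apply/eqP/rsum0 => x; rewrite /re.
  by case: hh' => ->; rewrite l2_0 /= !(mul0r, mulr0) addr0.
have [/norm0 f0|f0] := eqVneq (norm f) 0; first by apply: ng0; left.
have [/norm0 g0|g0] := eqVneq (norm g) 0; first by apply: ng0; right.
have := l2_sqnorm_ge0 ((norm g)%:C%C *: f + (- norm f)%:C%C *: g).
rewrite sqnormD !sqnormZ Re_innerZ -!norm_sqr /sqmod /= !expr0n !addr0.
set a := norm f; set b := norm g; set t := rsum _ => h.
have ab0 : 0 < a * b by rewrite mulr_gt0 // lt_neqAle eq_sym (f0, g0) sqrtr_ge0.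
rewrite -subr_ge0 -(pmulr_rge0 _ ab0) -(pmulr_rge0 _ (ltr0Sn R 1)).
by apply: le_trans h _; rewrite le_eqVlt; apply/orP; left; apply/eqP; ring.
Qed.

Definition l2_norm f : C := (norm f)%:C%C.

Let norm_triangle f g : l2_norm (f + g) <= l2_norm f + l2_norm g.
Proof.
rewrite -rmorphD lecR -ler_sqr ?nnegrE ?addr_ge0 ?sqrtr_ge0//.
rewrite norm_sqr sqnormD -!norm_sqr sqrrD.
by have := inner_le f g; rewrite -mulr_natl; lra.
Qed.

Let normZ a f : l2_norm (a *: f) = `|a| * l2_norm f.
Proof.
by rewrite /l2_norm /norm sqnormZ sqrtrM ?sqmod_ge0// normc_def -rmorphM.
Qed.

Let norm_eq0 f : l2_norm f = 0 -> f = 0.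
Proof.
move=> /(@complexI R) f0; apply: l2_sqnorm_eq0.
by rewrite -norm_sqr f0 expr0n.
Qed.

HB.instance Definition _ :=
  Lmodule_isNormed.Build C (l2 R T) norm_triangle normZ norm_eq0.

Lemma l2_normE f : `|f| = (Num.sqrt (l2_sqnorm f))%:C%C.
Proof. by []. Qed.

(** Coordinates of a Cauchy filter converge, and finite partial sums of the
    squared distances pass to the limit. *)
Let l2_complete (F : set_system (l2 R T)) : ProperFilter F -> cauchy F -> cvg F.
Proof.
move=> FF /cauchy_ballP cF.
have close (e : R) : 0 < e -> exists2 A, F A & forall f g, A f -> A g ->
    l2_sqnorm (f - g) < e ^+ 2.
  move=> e0; have e0C : 0 < e%:C%C by rewrite ltcR.
  have [[A B] /= [FA FB] AB] := cF _ e0C.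
  exists (A `&` B); first exact: filterI.
  move=> f g [Af _] [_ Bg]; have := AB (f, g) (conj Af Bg).
  rewrite -ball_normE /= l2_normE ltcR => h.
  by rewrite -norm_sqr ltr_sqr ?nnegrE ?sqrtr_ge0// ltW.
have coord (p : C -> R) (pB : forall z w, p (z - w) = p z - p w)
    (p_le : forall z, p z ^+ 2 <= sqmod z) x :
    exists l : R, (fun f : l2 R T => p (f x)) @ F --> l.
  apply/cvg_ex; apply: cauchy_cvg; apply: cauchy_exP => e e0.
  have [A FA Ae] := close e e0.
  have [f Af] := filter_ex FA; exists (p (f x));
  change (F [set g | ball (p (f x)) e (p (g x))]).
  apply: (filterS _ FA) => g Ag /=; rewrite -ball_normE /= -pB.
  rewrite -ltr_sqr ?nnegrE ?(ltW e0)// real_normK ?num_real//.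
  by apply: le_lt_trans (p_le _) _; apply: le_lt_trans (Ae f g Af Ag); exact: (sqmod_le_l2 (f - g)).
have ReB (z w : C) : Re (z - w) = Re z - Re w by case: z => ? ?; case: w.
have ImB (z w : C) : Im (z - w) = Im z - Im w by case: z => ? ?; case: w.
have Re_le (z : C) : Re z ^+ 2 <= sqmod z by rewrite lerDl sqr_ge0.
have Im_le (z : C) : Im z ^+ 2 <= sqmod z by rewrite lerDr sqr_ge0.
have [u uP] := choice (coord (@complex.Re R) ReB Re_le).
have [v vP] := choice (coord (@complex.Im R) ImB Im_le).
pose phi x : C^o := Complex (u x) (v x).
have lim_le (e : R) A f J : F A -> (forall g, A g -> l2_sqnorm (f - g) < e ^+ 2) ->
    \sum_(x <- J) sqmod (f x - phi x) <= e ^+ 2.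
  move=> FA Ae.
  have cvgJ : (fun g : l2 R T => \sum_(x <- J) sqmod (f x - g x)) @ F -->
      \sum_(x <- J) sqmod (f x - phi x).
    apply: cvg_big => [|x _]; first exact: add_continuous.
    rewrite /sqmod ReB ImB !expr2; under eq_fun do rewrite ReB ImB !expr2.
    by apply: cvgD; apply: cvgM; apply: cvgB; (exact: cvg_cst || exact: uP || exact: vP).
  apply: (cvgr_to_le cvgJ); apply: filterS FA => g /Ae/ltW; apply: le_trans.
  exact: (l2_sqnorm_ge (f - g)).
have phiP : phi \in @l2_pred R T.
  have [A FA Ae] := close 1 ltr01; have [f Af] := filter_ex FA.
  have sd : (fun x => f x - phi x) \in @l2_pred R T.
    apply/asboolP; exists (1 ^+ 2) => J.
    under eq_bigr do rewrite (ger0_norm (sqmod_ge0 _)).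
    by apply: (lim_le 1 A f J FA) => g Ag; exact: Ae.
  have -> : phi = (f : T -> C^o) - (fun x => f x - phi x).
    by apply/funext => x /=; rewrite [RHS]subKr.
  by apply: rpredB sd; exact: l2_funP.
apply/cvg_ex; exists (L2 phiP); apply/cvgrPdist_lt => e e0.
have eE : e = (Re e)%:C%C by rewrite RRe_real// gtr0_real.
have e20 : 0 < Re e / 2 by rewrite divr_gt0// -ltcR -eE.
have [A FA Ae] := close _ e20; apply: (filterS _ FA) => f Af.
rewrite /= distrC l2_normE eE ltcR.
have h : norm (f - L2 phiP) <= Re e / 2.
  rewrite -ler_sqr ?nnegrE ?sqrtr_ge0 ?(ltW e20)// norm_sqr.
  by apply: l2_sqnorm_le => J; apply: (lim_le _ A f J FA) => g Ag; exact: Ae.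
by apply: le_lt_trans h _; rewrite ltr_pdivrMr// ltr_pMr ?ltr1n// -ltcR -eE.
Qed.

HB.instance Definition _ := Uniform_isComplete.Build (l2 R T) l2_complete.

Let inner_norm f : l2_inner f f = `|f| ^+ 2.
Proof. by rewrite l2_inner_sqnorm l2_normE -rmorphXn /= sqr_sqrtr// l2_sqnorm_ge0. Qed.

Definition l2_hilbert : hilbertSpace R :=
  @HilbertSpace R (l2 R T) l2_inner inner_norm.

End L2InnerProduct.
Arguments l2_hilbert R T : clear implicits.

(** * The permutation representation *)

Section PermutationRepresentation.
Context {R : realType} {U : metricType R}.
Local Notation H := (l2_hilbert R U).
Implicit Types (g h : isom U) (f : l2 R U) (x y : U).

Let translate_pred g f : (fun x => f ((g^-1%g : isom U) x)) \in @l2_pred R U.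
Proof.
apply/asboolP.
apply: (@absolutely_summable_reindex _ _ (fun x => sqmod (f x)) (g^-1%g : isom U) g).
  exact: isomKV.
exact: summable_sqmod.
Qed.

Definition translate g f : l2 R U := L2 (translate_pred g f).

Lemma translateE g f x : translate g f x = f ((g^-1%g : isom U) x).
Proof. by []. Qed.

Let translate_linear g : linear (translate g).
Proof. by move=> a f f'; exact: l2P. Qed.

HB.instance Definition _ g :=
  GRing.isLinear.Build R[i] (l2 R U) (l2 R U) *:%R (translate g) (translate_linear g).

Let translateM g h f : translate (g * h)%g f = translate g (translate h f).
Proof. by apply: l2P => x; rewrite !translateE invgM. Qed.

Let translate1 f : translate 1%g f = f.
Proof. by apply: l2P => x; rewrite translateE invg1. Qed.

Let translate_inner g f f' :
  l2_inner (translate g f) (translate g f') = l2_inner f f'.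
Proof.
by apply: (@l2_inner_reindex _ _ (g^-1%g : isom U) g) => // x; [exact: isomKV|exact: isomVK].
Qed.

Let translate_unitary g : @Defs.unitary R H (translate g).
Proof.
split=> [f f'|f]; first exact: translate_inner.
exists (translate g^-1%g f).
have e : translate g (translate g^-1%g f) = f by rewrite -translateM mulgV translate1.
exact: e.
Qed.

Let translate_sqnorm g f : l2_sqnorm (translate g f) = l2_sqnorm f.
Proof. by apply: (@complexI R); rewrite -!l2_inner_sqnorm translate_inner. Qed.

Let translate_norm g f : `|translate g f| = `|f|.
Proof. by rewrite !l2_normE translate_sqnorm. Qed.

Let restrict_pred (J : {fset U}) f :
  (fun x => if x \in J then f x else 0) \in @l2_pred R U.
Proof.
apply/asboolP; apply: absolutely_summable_le (summable_sqmod f) _ => x.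
by case: ifP => // _; rewrite /sqmod /= expr0n addr0 normr0.
Qed.

(** Up to a small error [f] lives on a finite set [J], and the isometries close
    to [g0] agree with [g0] on [J]. *)
Let translate_continuous f : continuous (fun g => translate g f : H).
Proof.
move=> g0; apply/(@cvgrPdist_lt _ _ _ _ (nbhs_filter g0)) => e e0.
have eE : e = (complex.Re e)%:C%C by rewrite RRe_real// gtr0_real.
set r := complex.Re e in eE; have r0 : 0 < r by rewrite -ltcR -eE.
have [J JP] : exists J : {fset U},
    l2_sqnorm f - (r / 2) ^+ 2 < \sum_(x <- J) sqmod (f x).
  apply: contrapT => /forallNP nJ.
  have : l2_sqnorm f <= l2_sqnorm f - (r / 2) ^+ 2.
    by apply: l2_sqnorm_le => J; rewrite leNgt; apply/negP/nJ.
  have : 0 < (r / 2) ^+ 2 by rewrite exprn_gt0// divr_gt0.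
  by lra.
pose fJ := L2 (restrict_pred J f).
have fJ_small : l2_sqnorm (f - fJ) < (r / 2) ^+ 2.
  have dE x : sqmod ((f - fJ) x) + (if x \in J then sqmod (f x) else 0) <= sqmod (f x).
    rewrite l2D l2N /=; case: ifP => _; last by rewrite subr0 addr0.
    by rewrite subrr /sqmod /= expr0n addr0 add0r.
  have [M MP] : exists2 M, M < (r / 2) ^+ 2 & forall K : {fset U},
      \sum_(x <- K) sqmod ((f - fJ) x) <= M.
    exists (l2_sqnorm f - \sum_(x <- J) sqmod (f x)); first by lra.
    move=> K; rewrite lerBrDr; apply: le_trans (l2_sqnorm_ge f (K `|` J)%fset).
    apply: (@le_trans _ _ (\sum_(x <- (K `|` J)%fset) sqmod ((f - fJ) x) +
        \sum_(x <- (K `|` J)%fset) if x \in J then sqmod (f x) else 0)).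
      apply: lerD.
        by apply: ler_sum_fset => [x|]; [exact: sqmod_ge0|exact: fsubsetUl].
      rewrite -(big_fset_incl _ (fsubsetUr K J)) => [|x _ /negbTE->//].
      by rewrite big_seq [leRHS]big_seq; apply: ler_sum => x ->.
    by rewrite -big_split; apply: ler_sum => x _; exact: dE.
  move=> KM; apply: le_lt_trans MP; exact: l2_sqnorm_le.
have near : \forall g \near g0, forall x, x \in (J : seq U) -> (g : isom U) x = g0 x.
  elim: (J : seq U) => [|x s IHs]; first exact: (@filterE _ _ (nbhs_filter g0)).
  apply: (@filterS2 _ _ (nbhs_filter g0) _ _ _ _ (near_isom g0 x) IHs) => g gx gs y.
  by rewrite inE => /orP[/eqP->|/gs].
apply: (@filterS _ _ (nbhs_filter g0) _ _ _ near) => g gJ.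
have eqJ : translate g fJ = translate g0 fJ.
  have inv h h' y : (forall x, x \in J -> h x = h' x) ->
      (h^-1%g : isom U) y \in J -> (h'^-1%g : isom U) y = (h^-1%g : isom U) y.
    by move=> hJ yJ; apply: (isom_inj (g := h')); rewrite isomKV -hJ// isomKV.
  apply: l2P => y; rewrite !translateE.
  have := inv g g0 y gJ; have := inv g0 g y (fun x xJ => esym (gJ x xJ)).
  set a := (g^-1%g : isom U) y; set b := (g0^-1%g : isom U) y => ab ba /=.
  case: ifP => aJ; first by rewrite ba// aJ.
  by case: ifP => // bJ; move: aJ; rewrite ab// bJ.
have -> : translate g0 f - translate g f = translate g0 (f - fJ) - translate g (f - fJ).
  have lin h : translate h (f - fJ) = translate h f - translate h fJ.
    exact: (linearB (translate h)).
  by rewrite !lin eqJ opprB addrA subrK.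
apply: le_lt_trans (ler_normB _ _) _; rewrite !translate_norm l2_normE eE -rmorphD ltcR.
rewrite [ltRHS]splitr; have : Num.sqrt (l2_sqnorm (f - fJ)) < r / 2.
  have r20 : 0 <= r / 2 by rewrite divr_ge0// ltW.
  by rewrite -ltr_sqr ?nnegrE ?sqrtr_ge0// sqr_sqrtr// l2_sqnorm_ge0.
by move=> h; exact: ltrD.
Qed.

Definition permutation_rep : unitaryRep (isom U) H :=
  @UnitaryRep R (isom U) H (fun g => translate g) translateM translate_unitary
    translate_continuous.

Let sum_indicator (J : {fset U}) x :
  \sum_(y <- J) sqmod ((y == x)%:R : R[i]) = (x \in J)%:R.
Proof.
have sq (b : bool) : sqmod (b%:R : R[i]) = b%:R.
  by case: b; rewrite /sqmod /= ?expr1n ?expr0n addr0.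
under eq_bigr do rewrite sq.
case: (boolP (x \in J)) => xJ.
  rewrite (big_fsetD1 x)//= eqxx big_seq big1 ?addr0// => y.
  by rewrite in_fsetD1 => /andP[/negbTE->].
by rewrite big_seq big1// => y yJ; case: eqVneq => // yx; rewrite -yx yJ in xJ.
Qed.

Let delta_pred x : (fun y => (y == x)%:R) \in @l2_pred R U.
Proof.
apply/asboolP; exists 1 => J.
under eq_bigr do rewrite (ger0_norm (sqmod_ge0 _)).
by rewrite sum_indicator lern1 leq_b1.
Qed.

Definition delta x : l2 R U := L2 (delta_pred x).

Lemma delta_inner x : l2_inner (delta x) (delta x) = 1.
Proof.
rewrite l2_inner_sqnorm; suff -> : l2_sqnorm (delta x) = 1 by [].
apply/eqP; rewrite eq_le; apply/andP; split.
  by apply: l2_sqnorm_le => J; rewrite sum_indicator lern1 leq_b1.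
have := l2_sqnorm_ge (delta x) [fset x]%fset.
by rewrite sum_indicator in_fset1 eqxx.
Qed.

(** An invariant vector is constant by transitivity, hence zero because the
    space is infinite. *)
Lemma permutation_rep_no_invariant (Delta : set R) (hDelta : distance_set Delta)
    (hU : urysohn_space Delta U) (Dn0 : Delta <> [set 0]) (f : H) :
  Defs.invariant permutation_rep f -> f = 0.
Proof.
move=> finv; apply: l2P => x; rewrite l2_0.
have fconst y : (f : l2 R U) y = (f : l2 R U) x.
  have [z|g _ gy] := @transport_point _ _ _ hU fset0 y x.
    by rewrite in_fset0.
  have e : translate g f = f by exact: finv.
  by rewrite -{2}e translateE -gy isomVK.
have big n : exists J : {fset U}, #|` J| = n.
  elim: n => [|n [J <-]]; first by exists fset0; rewrite cardfs0.
  have [g _ gJ] := @move_point_off _ _ _ hDelta hU Dn0 fset0 J x (ltac:(by rewrite in_fset0)).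
  by exists (g x |` J)%fset; rewrite cardfsU1 gJ.
apply: sqmod_eq0; apply/eqP; rewrite eq_le sqmod_ge0 andbT leNgt; apply/negP => p.
set c := sqmod _ in p; set S := l2_sqnorm (f : l2 R U).
have [J Jn] := big (Num.trunc (S / c)).+1.
have := l2_sqnorm_ge (f : l2 R U) J.
under eq_bigr do rewrite fconst.
rewrite big_const_seq count_predT iter_addr_0 Jn -/c -/S -mulr_natl.
apply/negP; rewrite -ltNge -ltr_pdivrMr//.
exact: truncnS_gt.
Qed.

End PermutationRepresentation.

(** * Almost invariant vectors on a tree *)

Section RadialVectors.
Context {R : realType} {U : metricType R} {m : nat} (m0 : (0 < m)%N).
Context {g : 'I_m -> isom U} {time : 'I_m * bool -> U -> nat}.
Context {fresh : 'I_m * bool -> U -> bool} {x0 : U}.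
Context (gr : growth g time fresh x0).
Local Notation H := (l2_hilbert R U).
Local Notation label := ('I_m * bool)%type.
Implicit Types (l : label) (v w : H) (n k : nat).

Let L l : {linear H -> H} := @permutation_rep R U (generator g l).
Let root : H := delta x0.

Let LE l v x : (L l v : l2 R U) x = (v : l2 R U) (((generator g l)^-1)%g x).
Proof. by []. Qed.

Let L_rdot l v w : rdot (L l v) (L l w) = rdot v w.
Proof. exact: rep_rdot. Qed.

Let L_inv l v : L l (L (inv_label l) v) = v.
Proof.
apply: l2P => x; rewrite !LE; congr ((v : l2 R U) _).
apply: (isom_inj (g := generator g (inv_label l))); rewrite isomKV.
by apply: (isom_inj (g := generator g l)); rewrite isomKV -{1}(inv_labelK l) generator_inv.
Qed.

(** The sum of the indicators of the points [w x0], where [w] runs over the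
    reduced words of length [n.+1] with first letter [l]. *)
Fixpoint branch n l : H :=
  L l (if n is n'.+1 then \sum_(k | k != inv_label l) branch n' k else root).

(** The words of length [n] to which [l] may be prefixed. *)
Definition stem n l : H :=
  if n is n'.+1 then \sum_(k | k != inv_label l) branch n' k else root.

Let branchE n l : branch n l = L l (stem n l). Proof. by case: n. Qed.

Let l2_sumE (I : finType) (P : pred I) (F : I -> l2 R U) x :
  (\sum_(i | P i) F i) x = \sum_(i | P i) F i x.
Proof. by apply: (big_morph (fun f : l2 R U => f x)). Qed.

Let rootE y : (root : l2 R U) y = (y == x0)%:R. Proof. by []. Qed.

(** Away from the root, paths only run from old ends to fresh ends, so the
    branch [l] lives on the points that were born with their edge back
    along [l]. *)
Let branch_support n l x : (branch n l : l2 R U) x != 0 -> fresh (inv_label l) x.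
Proof.
elim: n l x => [|n IHn] l x; rewrite branchE LE;
    set y : U := ((generator g l)^-1)%g x;
    have -> : x = generator g l y by rewrite isomKV.
  rewrite rootE; have [yx0 _|_] := eqVneq y x0; last by rewrite eqxx.
  by rewrite (fresh_inv gr) yx0 (fresh_root gr).
rewrite /= => sy; rewrite (fresh_inv gr).
have [k kl ky] : exists2 k, k != inv_label l & (branch n k : l2 R U) y != 0.
  apply: contrapT => nk; move/eqP: sy; apply.
  rewrite l2_sumE big1// => k kl; apply/eqP; apply: contraT => ky.
  by case: nk; exists k.
apply: contra kl => fl; apply/eqP.
by rewrite -(fresh_uniq gr (IHn _ _ ky) fl) inv_labelK.
Qed.

Let rdot_disjoint v w :
  (forall x, (v : l2 R U) x != 0 -> (w : l2 R U) x != 0 -> False) -> rdot v w = 0.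
Proof.
move=> vw; rewrite /rdot [inner _ _ _](@l2_inner_disjoint _ _ v w)// => x.
case: (eqVneq ((v : l2 R U) x) 0) => [->|vx]; first by left.
case: (eqVneq ((w : l2 R U) x) 0) => [->|wx]; first by right.
by case: (vw x vx wx).
Qed.

Let root_branch n l : rdot root (branch n l) = 0.
Proof.
apply: rdot_disjoint => x; rewrite rootE; have [->|_] := eqVneq x x0; last by rewrite eqxx.
by move=> _ /branch_support; apply/negP; exact: (fresh_root gr).
Qed.

Let root_root : rdot root root = 1.
Proof. by rewrite /rdot [inner _ _ _]delta_inner. Qed.

Let q : R := 2 * m%:R - 1.

Let card_other l : #|[pred k : label | k != l]| = (2 * m).-1.
Proof.
have := cardC1 l; rewrite card_prod card_ord card_bool mulnC => <-.
by apply: eq_card.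
Qed.

Let qE : (2 * m).-1%:R = q.
Proof.
by rewrite /q -subn1 natrB ?muln_gt0// natrM.
Qed.

Let sum_other l (r : R) : \sum_(k : label | k != l) r = q * r.
Proof. by rewrite sumr_const card_other -mulr_natl qE. Qed.

Let branch_rdot n k l l' :
  rdot (branch n l) (branch k l') = if (n == k) && (l == l') then q ^+ n else 0.
Proof.
have [<-|ll'] := eqVneq l l'; rewrite ?andbT ?andbF; last first.
  apply: rdot_disjoint => x /branch_support fx /branch_support fx'.
  have := fresh_uniq gr fx fx' => /(can_inj (@inv_labelK m)) e.
  by rewrite e eqxx in ll'.
elim: n k l {l'} => [|n IHn] [|k] l; rewrite !branchE L_rdot /=.
- exact: root_root.
- by rewrite rdot_sumr big1// => k' _; exact: root_branch.
- by rewrite rdot_suml big1// => k' _; rewrite rdotC; exact: root_branch.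
rewrite rdot_suml eqSS (eq_bigr (fun=> if n == k then q ^+ n else 0)) => [|j jl].
  by rewrite sum_other; case: ifP; rewrite ?mulr0// exprS.
rewrite rdot_sumr (bigD1 j)//= IHn big1 ?addr0// => j' /andP[_ j'j].
apply: rdot_disjoint => x /branch_support fx /branch_support fx'.
have := fresh_uniq gr fx fx' => /(can_inj (@inv_labelK m)) e.
by rewrite e eqxx in j'j.
Qed.

(** The sum of the indicators of the points [w x0], for [w] reduced of length
    [n]. *)
Definition sphere n : H := if n is n'.+1 then \sum_l branch n' l else root.

Let sphereE n l :
  sphere n = stem n l + (if n is n'.+1 then branch n' (inv_label l) else 0).
Proof.
case: n => [|n] /=; first by rewrite addr0.
by rewrite (bigD1 (inv_label l))//= addrC.
Qed.

Let branch_sphere n l k :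
  rdot (branch n l) (sphere k) = if k == n.+1 then q ^+ n else 0.
Proof.
case: k => [|k] /=; first by rewrite rdotC root_branch.
rewrite rdot_sumr (bigD1 l)//= branch_rdot eqxx andbT big1 ?addr0 => [|l' l'l].
  by rewrite eqSS eq_sym.
by rewrite branch_rdot (eq_sym l) (negbTE l'l) andbF.
Qed.

Let stem_sphere n l k : rdot (stem n l) (sphere k) = if k == n then q ^+ n else 0.
Proof.
case: n => [|n] /=.
  case: k => [|k] /=; first exact: root_root.
  by rewrite rdot_sumr big1// => l' _; exact: root_branch.
rewrite rdot_suml (eq_bigr (fun=> if k == n.+1 then q ^+ n else 0)) => [|l' _].
  by rewrite sum_other; case: ifP; rewrite ?mulr0// exprS.
exact: branch_sphere.
Qed.

Let sphere_rdot n k : rdot (sphere n) (sphere k) =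
  if n == k then (if n is n'.+1 then 2 * m%:R * q ^+ n' else 1) else 0.
Proof.
case: n => [|n].
  have := stem_sphere 0 (Ordinal m0, true) k; rewrite /= eq_sym expr0.
  by case: k.
rewrite /= rdot_suml (eq_bigr (fun=> if k == n.+1 then q ^+ n else 0)) => [|l' _].
  rewrite sumr_const card_prod card_ord card_bool eq_sym.
  by case: ifP => _; rewrite ?mul0rn// -[LHS]mulr_natl natrM (mulrC m%:R).
exact: branch_sphere.
Qed.

#[local] Arguments sphere : simpl never.

Let L_sphere l n k : rdot (L l (sphere n)) (sphere k) =
  (if k == n.+1 then q ^+ n else 0) + (if n == k.+1 then q ^+ k else 0).
Proof.
rewrite (sphereE n l) linearD rdotDl -branchE branch_sphere; congr (_ + _).
case: n => [|n]; first by rewrite linear0 rdot0l.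
rewrite branchE L_inv stem_sphere eqSS eq_sym.
by case: eqVneq => // ->.
Qed.

Let q1 : 1 <= q. Proof.
have m1 : 1 <= m%:R :> R by rewrite ler1n.
by rewrite /q; lra.
Qed.

Let t : R := Num.sqrt q.
Let t2 : t ^+ 2 = q. Proof. by rewrite sqr_sqrtr//; have := q1; lra. Qed.
Let t0 : 0 < t. Proof. by rewrite sqrtr_gt0; have := q1; lra. Qed.

(** Up to a factor linear in [n], this is the positive radial eigenfunction at
    the top of the spectrum of the tree. All spheres but the first contribute
    equally to the norm, and cutting off at radius [N] costs a bounded amount. *)
Definition radial N : H := \sum_(n < N.+1) ((t^-1 ^+ n)%:C%C *: sphere n).

Let radial0 : radial 0 = root.
Proof. by rewrite /radial big_ord1 expr0 scale1r. Qed.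

Let radialS N :
  radial N.+1 = radial N + (t^-1 ^+ N.+1)%:C%C *: sphere N.+1.
Proof. by rewrite /radial big_ord_recr. Qed.

Let radial_sphere N : rdot (radial N) (sphere N.+1) = 0.
Proof.
by rewrite rdot_suml big1// => n _; rewrite rdotZl sphere_rdot ltn_eqF ?mulr0.
Qed.

Let tq n : t^-1 ^+ n.+1 * (t^-1 ^+ n * q ^+ n) = t^-1.
Proof.
rewrite exprS -mulrA [_ * (_ * q ^+ n)]mulrA -expr2 -exprM mulnC exprM.
by rewrite exprVn t2 -exprMn mulVf ?expr1n ?mulr1// -t2 sqrf_eq0 gt_eqF.
Qed.

Let L_sphere_radial l N :
  rdot (L l (sphere N.+1)) (radial N) = t^-1 ^+ N * q ^+ N.
Proof.
rewrite /radial rdot_sumr big_ord_recr /= big1 ?add0r => [|n _].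
  by rewrite rdotZr L_sphere eqxx eq_sym gtn_eqF ?add0r// ltnS leqnSn.
rewrite rdotZr L_sphere !ifF ?addr0 ?mulr0//.
  by rewrite eqSS gtn_eqF//; exact: ltn_ord.
by rewrite ltn_eqF// (ltn_trans (ltn_ord n))// ltnS leqW.
Qed.

Let L_radial_sphere l N :
  rdot (L l (radial N)) (sphere N.+1) = t^-1 ^+ N * q ^+ N.
Proof.
have -> : radial N = \sum_(n < N) (t^-1 ^+ n)%:C%C *: sphere n
    + (t^-1 ^+ N)%:C%C *: sphere N by rewrite /radial big_ord_recr.
rewrite linearD linear_sum rdotDl rdot_suml big1 ?add0r => [|n _].
  by rewrite linearZ rdotZl L_sphere eqxx ltn_eqF ?addr0.
rewrite linearZ rdotZl L_sphere !ifF ?addr0 ?mulr0//.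
  by rewrite ltn_eqF// (ltn_trans (ltn_ord n))// ltnS leqW.
by rewrite eqSS gtn_eqF//; exact: ltn_ord.
Qed.

Lemma radial_norm N : nrm (radial N) ^+ 2 = 1 + N%:R * (2 * m%:R / q).
Proof.
rewrite -rdotxx; elim: N => [|N IHN].
  by rewrite radial0 root_root mul0r addr0.
rewrite radialS rdotDl !rdotDr IHN rdotZl !rdotZr (rdotC (sphere _)) rdotZl.
rewrite radial_sphere !mulr0 addr0 add0r sphere_rdot eqxx -(natr1 N) (mulrDl N%:R) mul1r addrA.
congr (_ + _).
transitivity (2 * m%:R * t^-1 * (t^-1 ^+ N.+1 * (t^-1 ^+ N * q ^+ N))).
  by rewrite exprS; ring.
by rewrite tq -mulrA -expr2 exprVn t2.
Qed.

Lemma radial_coefficient l N :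
  rdot (L l (radial N)) (radial N) = N%:R * (2 * t^-1).
Proof.
elim: N => [|N IHN].
  by rewrite radial0 (L_sphere l 0 0) addr0 mul0r.
rewrite radialS linearD linearZ rdotDl !rdotDr IHN rdotZl !rdotZr rdotZl.
rewrite L_sphere_radial L_radial_sphere tq L_sphere.
rewrite ltn_eqF// addr0 !mulr0 addr0 -(natr1 N) (mulrDl N%:R) mul1r.
by rewrite -addrA; congr (_ + _); ring.
Qed.

(** For every generator the ratio of [radial_coefficient] to [radial_norm]
    tends to [t / m] as [N] grows. *)
Lemma radial_almost_invariant (eps : R) : 0 <= eps ->
  2 - 2 * t / m%:R < eps ^+ 2 ->
  exists2 xi : H, xi != 0 &
    forall i, nrm (permutation_rep (g i) xi - xi) <= eps * nrm xi.
Proof.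
move=> eps0 lt_eps; pose kappa := eps ^+ 2 - (2 - 2 * t / m%:R).
have k0 : 0 < kappa by rewrite subr_gt0.
have mR : 0 < m%:R :> R by rewrite ltr0n.
(* The inequality between squared norms amounts to [hN]. *)
pose N := (Num.trunc (t ^+ 3 / (m%:R ^+ 2 * kappa))).+1.
have hN : t ^+ 3 <= N%:R * (m%:R ^+ 2 * kappa).
  rewrite -ler_pdivrMr ?mulr_gt0 ?exprn_gt0//.
  exact/ltW/truncnS_gt.
have n1 : 1 <= nrm (radial N) ^+ 2.
  rewrite radial_norm lerDl mulr_ge0 ?ler0n// divr_ge0 ?mulr_ge0 ?ltW//.
  by have := q1; lra.
exists (radial N) => [|i].
  by apply: contraTneq n1 => ->; rewrite nrm0 expr0n /= -ltNge.
rewrite -ler_sqr ?nnegrE ?mulr_ge0 ?nrm_ge0// exprMn sqr_nrmB rep_nrm.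
have -> : rdot (permutation_rep (g i) (radial N)) (radial N) = N%:R * (2 * t^-1).
  exact: (radial_coefficient (i, true) N).
rewrite radial_norm -t2.
have -> : eps ^+ 2 = kappa + 2 - 2 * t / m%:R by rewrite /kappa; ring.
have tn0 : t != 0 by rewrite gt_eqF.
have mn0 : m%:R != 0 :> R by rewrite gt_eqF.
set M := m%:R in mR hN mn0 *; set n := N%:R in hN *.
rewrite -subr_ge0.
have -> : (kappa + 2 - 2 * t / M) * (1 + n * (2 * M / t ^+ 2))
    - (1 + n * (2 * M / t ^+ 2) + (1 + n * (2 * M / t ^+ 2)) - 2 * (n * (2 * t^-1))) =
    kappa + 2 * (n * (M ^+ 2 * kappa) - t ^+ 3) / (M * t ^+ 2).
  by field; rewrite tn0 mn0.
by rewrite addr_ge0 ?(ltW k0)// divr_ge0 ?mulr_ge0 ?subr_ge0// ?ltW.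
Qed.

End RadialVectors.

(** * Property (T) *)

Section KazhdanConstant.
Context {R : realType} {Delta : set R} {U : metricType R}.
Context (hDelta : distance_set Delta) (hU : urysohn_space Delta U).
Context (Dn0 : Delta <> [set 0]).
Context {m : nat} (m0 : (0 < m)%N) {g : 'I_m -> isom U}.
Context {time : 'I_m * bool -> U -> nat} {fresh : 'I_m * bool -> U -> bool} {x0 : U}.
Context (gr : growth g time fresh x0).

Let t : R := Num.sqrt (2 * m%:R - 1).
Let kappa : R := Num.sqrt (2 - 2 * t / m%:R).

Let m1 : 1 <= m%:R :> R. Proof. by rewrite ler1n. Qed.

Let t2 : t ^+ 2 = 2 * m%:R - 1.
Proof. by rewrite sqr_sqrtr//; have := m1; lra. Qed.

Let t_le : t <= m%:R.
Proof.
rewrite -ler_sqr ?nnegrE ?sqrtr_ge0 ?ler0n// t2.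
by have := sqr_ge0 (m%:R - 1 : R); rewrite !expr2; lra.
Qed.

Let kappa2 : kappa ^+ 2 = 2 - 2 * t / m%:R.
Proof.
rewrite sqr_sqrtr// subr_ge0 ler_pdivrMr; last by have := m1; lra.
by have := t_le; lra.
Qed.

Let almost_invariantE (H : hilbertSpace R) (pi : unitaryRep (isom U) H) eps xi :
  almost_invariant pi (range g) eps xi <->
  forall i, nrm (pi (g i) xi - xi) <= eps * nrm xi.
Proof.
split=> [h i|h _ [i _ <-]].
  by have := h (g i) (ex_intro2 _ _ i I erefl); rewrite !nrmE -rmorphM lecR.
by rewrite !nrmE -rmorphM lecR.
Qed.

Let no_invariant_of (H : hilbertSpace R) (pi : unitaryRep (isom U) H) :
  ~ (exists2 xi : H, xi != 0 & Defs.invariant pi xi) ->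
  forall x, Defs.invariant pi x -> x = 0.
Proof.
by move=> nx x xinv; apply/eqP; apply: contraT => x_neq0; case: nx; exists x.
Qed.

(** The real parts of the coefficients of a vector moved by at most [eps] are
    at least [1 - eps ^+ 2 / 2], and their sum exceeds the spectral bound. *)
Lemma below_kappa eps : 0 <= eps -> eps < kappa ->
  almost_invariant_invariant (range g) eps.
Proof.
move=> eps0 lt_eps H pi [xi xi0 /almost_invariantE hxi].
apply: contrapT => /no_invariant_of no_inv.
have := spectral_bound hDelta hU Dn0 no_inv gr xi m0; rewrite -/t; apply/negP.
have n0 : 0 < nrm xi ^+ 2 by rewrite exprn_gt0// nrm_gt0.
have coef i : (1 - eps ^+ 2 / 2) * nrm xi ^+ 2 <= rdot (pi (g i) xi) xi.
  have : nrm (pi (g i) xi - xi) ^+ 2 <= (eps * nrm xi) ^+ 2.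
    by rewrite ler_sqr ?nnegrE ?mulr_ge0 ?nrm_ge0.
  by rewrite sqr_nrmB rep_nrm exprMn; lra.
rewrite -ltNge; apply: lt_le_trans (ler_sum _ (fun i _ => coef i)).
rewrite sumr_const card_ord -[ltRHS]mulr_natl [ltRHS]mulrA ltr_pM2r//.
have : eps ^+ 2 < kappa ^+ 2 by rewrite ltr_sqr ?nnegrE ?sqrtr_ge0.
rewrite kappa2 => e2; have mR : 0 < m%:R :> R by rewrite ltr0n.
rewrite -ltr_pdivrMl//; have -> : m%:R^-1 * t = t / m%:R by rewrite mulrC.
by lra.
Qed.

(** This matters when [m = 1] and [kappa = 0]: exact invariance under a single
    generator has to be excluded. *)
Lemma exactly_invariant_generators : almost_invariant_invariant (R := R) (range g) 0.
Proof.
move=> H pi [xi xi0 /almost_invariantE hxi].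
apply: contrapT => /no_invariant_of no_inv.
have := generator_no_invariant hDelta hU Dn0 no_inv gr (i := Ordinal m0) (x := xi).
move=> h; move/eqP: xi0; apply; apply: h.
apply/eqP; rewrite -subr_eq0; apply/eqP/nrm_eq0/eqP.
by rewrite eq_le nrm_ge0 andbT -(mul0r (nrm xi)) hxi.
Qed.

Lemma above_kappa eps : 0 <= eps -> kappa < eps ->
  ~ almost_invariant_invariant (range g) eps.
Proof.
move=> eps0 lt_eps h.
have lt2 : 2 - 2 * t / m%:R < eps ^+ 2.
  by rewrite -kappa2 ltr_sqr ?nnegrE ?sqrtr_ge0.
have [xi xi0 hxi] := radial_almost_invariant m0 gr eps0 lt2.
have [|f f0 finv] := h (l2_hilbert R U) permutation_rep.
  by exists xi => //; apply/almost_invariantE.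
by move/eqP: f0; apply; exact: permutation_rep_no_invariant hDelta hU Dn0 f finv.
Qed.

Lemma optimal_constant : optimal_kazhdan_constant (range g) = kappa%:E.
Proof.
apply/eqP; rewrite eq_le; apply/andP; split.
  apply: ge_ereal_sup => _ [eps [eps0 h] <-]; rewrite lee_fin leNgt.
  by apply/negP => /(above_kappa eps0).
have [k0|k0] := eqVneq kappa 0.
  rewrite k0; apply: ereal_sup_ubound; exists 0 => //.
  by split => //; exact: exactly_invariant_generators.
have kpos : 0 < kappa by rewrite lt_neqAle eq_sym k0 sqrtr_ge0.
apply/lee_addgt0Pr => e e0; rewrite -leeBlDr//.
pose d := Num.min (e / 2) (kappa / 2).
have d0 : 0 < d by rewrite lt_min !divr_gt0.
have dk : d < kappa by rewrite gt_min; apply/orP; right; rewrite ltr_pdivrMr// ltr_pMr ?ltr1n.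
apply: (@le_trans _ _ (kappa - d)%:E).
  rewrite -EFinB lee_fin lerD2l lerN2 ge_min; apply/orP; left.
  by rewrite ler_pdivrMr// ler_peMr ?ltW// ltr1n.
apply: ereal_sup_ubound; exists (kappa - d) => //; split.
  by rewrite /= subr_ge0 ltW.
by apply: below_kappa; rewrite ?subr_ge0 ?ltW// gtrBl.
Qed.

Lemma card_range_generators : (range g #= `I_m)%card.
Proof.
have gI : (range g #= [set: 'I_m])%card.
  by apply: inj_card_eq => i j _ _; exact: growth_inj gr _ _.
apply: (card_eq_trans gI).
have -> : `I_m = (@nat_of_ord m) @` [set: 'I_m].
  apply/seteqP; split=> [k km|_ [i _ <-]]; last exact: ltn_ord.
  by exists (Ordinal km).
by rewrite card_eq_sym; apply: inj_card_eq => i j _ _; exact: ord_inj.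
Qed.

Lemma kazhdan_pair_generators : (2 <= m)%N -> kazhdan_pair (range g) (kappa / 2).
Proof.
move=> m2; have kpos : 0 < kappa.
  rewrite sqrtr_gt0 subr_gt0 ltr_pdivrMr; last by have := m1; lra.
  have : t < m%:R.
    rewrite -ltr_sqr ?nnegrE ?sqrtr_ge0 ?ler0n// t2.
    have : 2 <= m%:R :> R by rewrite ler_nat.
    by rewrite expr2; nra.
  by lra.
split; first last.
- by apply: below_kappa; lra.
- by rewrite divr_gt0.
- apply: finite_compact; exact: finite_image.
Qed.

End KazhdanConstant.

Lemma trivial_property_T (R : realType) (U : metricType R) :
  (forall x y : U, x = y) -> property_T R (isom U).
Proof.
move=> U1; exists set0, 1; split=> //; first exact: compact0.
move=> H pi [xi xi0 _]; exists xi => // g.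
have -> : g = 1%g by apply: isomP => x; exact: U1.
exact: rep1.
Qed.

Lemma urysohn_space_nonempty (R : realType) (Delta : set R) (U : metricType R) :
  distance_set Delta -> urysohn_space Delta U -> exists x : U, True.
Proof.
move=> hDelta [_ _ _ univ].
pose d (_ _ : unit) : R := 0.
have dpos x y : d x y = 0 -> x = y by case: x; case: y.
have dtri y x z : d x z <= d x y + d y z by rewrite addr0.
have [M [e [esurj eM]]] := metric_of_distance (fun=> erefl) dpos (fun _ _ => erefl) dtri.
have [||f _] := univ M; last by exists (f (e tt)).
  have -> : [set: M] = e @` [set: unit].
    by apply/seteqP; split=> // y _; have [x <-] := esurj y; exists x.
  by apply: sub_countable; [exact: card_image_le|exact: countableP].
move=> x y; have [p <-] := esurj x; have [q <-] := esurj y; rewrite eM.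
exact: distance_set0 hDelta.
Qed.

Theorem theorem1p3 (R : realType) (Delta : set R) (U : metricType R)
  (hDelta : distance_set Delta) (hU : urysohn_space Delta U) :
  property_T R (isom U) /\
  (Delta <> [set 0] -> forall m : nat, (1 <= m)%N ->
    exists Q : set (isom U),
      [/\ (Q #= `I_m)%card,
          ((2 <= m)%N -> kazhdan_set (R := R) Q) &
          optimal_kazhdan_constant Q =
            (Num.sqrt (2 - 2 * Num.sqrt (2 * m%:R - 1) / m%:R) : R)%:E]).
Proof.
have [x0 _] := urysohn_space_nonempty hDelta hU.
split=> [|Dn0 m m0].
  have [D0|Dn0] := pselect (Delta = [set 0]).
    apply: trivial_property_T => x y; have [_ hD _ _] := hU.
    by apply: mdist_positivity; have := hD x y; rewrite D0.
  (* With two generators the constant is positive. *)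
  have [g [time [fresh gr]]] := growth_exists hDelta hU Dn0 x0 (ltn0Sn 1 : 0 < 2)%N.
  exists (range g); eexists.
  exact: (kazhdan_pair_generators hDelta hU Dn0 (ltn0Sn 1) gr (leqnn 2)).
have [g [time [fresh gr]]] := growth_exists hDelta hU Dn0 x0 m0.
exists (range g); split.
- exact: card_range_generators gr.
- by move=> m2; eexists; exact: (kazhdan_pair_generators hDelta hU Dn0 m0 gr m2).
- exact: (optimal_constant hDelta hU Dn0 m0 gr).
Qed.
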